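(* Let $n\ge1$ and $k\ge 0$ be integers. There exists a constant $C>0$ depending only on $n$ and $k$ such that for every $p\in[1,\infty]$, every $s\in[0,1]$, every $u\in W^{k+s,p}(\mathbb{R}^n)$ and every $y\in\mathbb{R}^n$, $$\|u(\cdot+y)-P_ku(\cdot,y)\|_{L^p(\mathbb{R}^n)}\le C\,[u]_{W^{k+s,p}(\mathbb{R}^n)}\,|y|^{k+s}.$$
   Context: $P_ku(x,y)=\sum_{|\alpha|\le k}\frac{D^\alpha u(x)}{\alpha!}y^\alpha$ is the Taylor polynomial of order $k$ of $u$ centred at $x$ (standard multi-index notation, $D^\alpha u$ weak derivatives). For $s\in(0,1)$ and $p\in[1,\infty)$ the normalised Gagliardo seminorm is $$[v]_{W^{s,p}(\mathbb{R}^n)}=\left(s(1-s)\int_{\mathbb{R}^n}\int_{\mathbb{R}^n}\frac{|v(x)-v(y)|^p}{|x-y|^{n+sp}}\,dx\,dy\right)^{1/p}.$$ In the limit cases: $[v]_{W^{0,p}(\mathbb{R}^n)}=\|v\|_{L^p(\mathbb{R}^n)}$ and $[v]_{W^{1,p}(\mathbb{R}^n)}=\|\nabla v\|_{L^p(\mathbb{R}^n)}$ for $p\in[1,\infty]$, and $[v]_{W^{s,\infty}(\mathbb{R}^n)}=\operatorname{ess\,sup}_{x,y\in\mathbb{R}^n}\frac{|v(x)-v(y)|}{|x-y|^s}$ for $s\in(0,1)$. For an integer $k\ge0$ and $s\in[0,1]$, set $[u]_{W^{k+s,p}(\mathbb{R}^n)}=\max_{|\alpha|=k}[D^\alpha u]_{W^{s,p}(\mathbb{R}^n)}$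 and $W^{k+s,p}(\mathbb{R}^n)=\{u\in W^{k,p}(\mathbb{R}^n): [u]_{W^{k+s,p}(\mathbb{R}^n)}<+\infty\}$, where $W^{k,p}(\mathbb{R}^n)$ is the usual integer-order Sobolev space ($W^{0,p}=L^p$). (The seminorm is understood with the given pair $(k,s)$; for integer total order the two possible readings are equivalent up to constants depending only on $n$.) *)

(* Defs.v *)
From HB Require Import structures.
From mathcomp Require Import all_boot all_order all_algebra.
From mathcomp Require Import all_classical all_reals all_analysis.
From mathcomp Require Import ess_sup_inf.

Set Implicit Arguments.
Unset Strict Implicit.
Unset Printing Implicit Defensive.
Import Order.TTheory GRing.Theory Num.Theory.
Import numFieldNormedType.Exports.

Local Open Scope classical_set_scope.
Local Open Scope ring_scope.

(** The sigma-algebra on ['rV[T]_n] is generated by the coordinates. For [T] the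
    reals this is the Borel one: every Lebesgue measurable function agrees
    almost everywhere with a measurable function in this sense. *)

Definition measure_rV_display : measure_display -> measure_display.
Proof. exact. Qed.

Section measurable_rV.
Context {d} {T : sigmaRingType d}.
Variable n : nat.

Let coord : 'I_n -> 'rV[T]_n -> T := fun i x => x ord0 i.

Let rV_set0 : g_sigma_preimage coord set0.
Proof. exact: sigma_algebra0. Qed.

Let rV_setC A : g_sigma_preimage coord A -> g_sigma_preimage coord (~` A).
Proof. exact: sigma_algebraC. Qed.

Let rV_bigcup (F : _^nat) : (forall i, g_sigma_preimage coord (F i)) ->
  g_sigma_preimage coord (\bigcup_i (F i)).
Proof. exact: sigma_algebra_bigcup. Qed.

HB.instance Definition _ := @isMeasurable.Build (measure_rV_display d)
  'rV[T]_n (g_sigma_preimage coord) rV_set0 rV_setC rV_bigcup.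

End measurable_rV.

Lemma measurable_fun_rVP d d' (T1 : measurableType d) (T2 : measurableType d')
    n (f : T1 -> 'rV[T2]_n) :
  measurable_fun [set: T1] f <->
  forall i, measurable_fun [set: T1] (fun x => f x ord0 i).
Proof.
apply: (@iff_trans _ (g_sigma_preimage
    (fun i => (fun x : 'rV[T2]_n => x ord0 i) \o f) `<=` measurable)).
  rewrite g_sigma_preimage_comp; split=> [mf A [/= C preC <-]|prefS].
    exact: mf.
  by move=> _ A mA; apply: prefS; exists A.
split=> [fS i|mf].
- move=> _ A mA; apply: fS; apply: sub_sigma_algebra.
  rewrite -bigcup_seq/=; exists i => /=; first by rewrite mem_index_enum.
  by exists A.
- apply: smallest_sub; first exact: sigma_algebra_measurable.
  rewrite -bigcup_seq/=; apply: bigcup_sub => i _.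
  by move=> A [B mB <-]; exact: mf.
Qed.

Section lebesgue_rV.
Context {R : realType}.
Local Open Scope ereal_scope.

Definition rV_cons n (z : measurableTypeR R * 'rV[R]_n) : 'rV[R]_n.+1 :=
  \row_i if unlift ord0 i is Some j then z.2 ord0 j else z.1.

Lemma measurable_coord n (i : 'I_n) :
  measurable_fun [set: 'rV[R]_n] (fun x => x ord0 i).
Proof. by move: i; apply/measurable_fun_rVP; exact: measurable_id. Qed.

Lemma measurable_rV_cons n :
  measurable_fun [set: measurableTypeR R * 'rV[R]_n] (@rV_cons n).
Proof.
apply/measurable_fun_rVP => i; rewrite /rV_cons.
under eq_fun do rewrite mxE.
case: (unlift ord0 i) => [j|]; last exact: measurable_fst.
exact: measurableT_comp (measurable_coord j) measurable_snd.
Qed.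

Section step.
Context (n : nat) (mu : {sigma_finite_measure set 'rV[R]_n -> \bar R}).

(** Lebesgue measure times [mu], transported along R x R^n = R^(n+1). *)
Definition lebesgue_rV_step : set 'rV[R]_n.+1 -> \bar R :=
  pushforward (@lebesgue_measure R \x mu) (@rV_cons n).

HB.instance Definition _ := Measure.copy lebesgue_rV_step
  (measure_function_pushforward__canonical__measure_function_Measure
     (@lebesgue_measure R \x mu) (@measurable_rV_cons n)).

Let lebesgue_rV_step_sigma_finite : sigma_finite setT lebesgue_rV_step.
Proof.
pose b (x : 'rV[R]_n.+1) : measurableTypeR R * 'rV[R]_n :=
  (x ord0 ord0, \row_j x ord0 (lift ord0 j)).
have bK z : b (rV_cons z) = z.
  case: z => a v; rewrite /b /rV_cons mxE unlift_none; congr pair.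
  by apply/rowP => j; rewrite !mxE liftK.
have mb : measurable_fun setT b.
  apply/measurable_fun_pairP; split; first exact: measurable_coord.
  by apply/measurable_fun_rVP => j; under eq_fun do rewrite mxE;
    exact: measurable_coord.
have /sigma_finiteP[F [TF ndF Foo]] := sigma_finiteT (@lebesgue_measure R).
have /sigma_finiteP[G [TG ndG Goo]] := sigma_finiteT mu.
have mFG k : measurable (F k `*` G k).
  by apply: measurableX; [exact: (Foo k).1|exact: (Goo k).1].
exists (fun k => b @^-1` (F k `*` G k)).
  rewrite -preimage_bigcup (_ : \bigcup_k _ = setT) ?preimage_setT//.
  apply/seteqP; split => // -[x y] _.
  have [i _ Fnx] : (\bigcup_j F j) x by rewrite -TF.
  have [k _ Gky] : (\bigcup_j G j) y by rewrite -TG.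
  exists (maxn i k) => //; split => /=.
    by move: x Fnx; exact/subsetPset/ndF/leq_maxl.
  by move: y Gky; exact/subsetPset/ndG/leq_maxr.
move=> k; split; first by rewrite -[X in measurable X]setTI; exact: mb.
rewrite /lebesgue_rV_step /pushforward -comp_preimage.
rewrite (_ : b \o _ = id); last by apply/funext => z /=; exact: bK.
rewrite preimage_id product_measure1E; [|exact: (Foo k).1|exact: (Goo k).1].
rewrite lte_mul_pinfty// ?(Goo k).2//.
by rewrite ge0_fin_numE ?(Foo k).2.
Qed.

HB.instance Definition _ := Measure_isSigmaFinite.Build _ _ _
  lebesgue_rV_step lebesgue_rV_step_sigma_finite.
End step.

Fixpoint lebesgue_rV n : {sigma_finite_measure set 'rV[R]_n -> \bar R} :=
  match n with
  | 0%N => \d_(0%R : 'rV[R]_0)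
  | m.+1 => lebesgue_rV_step (lebesgue_rV m)
  end.

End lebesgue_rV.
Arguments lebesgue_rV R n : clear implicits.

Lemma lebesgue_rV_box (R : realType) n (A : 'I_n -> set R) : (forall i, measurable (A i)) ->
  measurable [set x : 'rV[R]_n | forall i, A i (x ord0 i)] /\
  lebesgue_rV R n [set x | forall i, A i (x ord0 i)] = (\prod_(i < n) lebesgue_measure (A i))%E.
Proof.
elim: n A => [|n IH] A mA.
  set S := (S in lebesgue_rV R 0 S).
  have E : S = setT by apply/seteqP; split => // x _ [].
  split; first by change (measurable S); rewrite E; exact: measurableT.
  by rewrite big_ord0 E /= /dirac indicE mem_set.
have [mB EB] := IH (fun i => A (lift ord0 i)) (fun i => mA _).
split.
  rewrite (_ : [set x | _] = \bigcap_(i in [set: 'I_n.+1]) ((fun x : 'rV[R]_n.+1 => x ord0 i) @^-1` A i)); last first.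
    by apply/seteqP; split => x /= h i; [move=> _|]; exact: h.
  apply: fin_bigcap_measurable => // i _.
  by rewrite -[X in measurable X]setTI; apply: measurable_coord.
rewrite big_ord_recl -EB /= /lebesgue_rV_step /pushforward.
rewrite -(product_measure1E lebesgue_measure (lebesgue_rV R n)) //; last exact: mA.
congr (product_measure1 _ _ _).
apply/seteqP; split => -[a v] /=.
  move=> h; split; first by have := h ord0; rewrite mxE unlift_none.
  by move=> i /=; have := h (lift ord0 i); rewrite mxE liftK.
move=> [h1 h2] i; rewrite mxE; case: (unliftP ord0 i) => [j ->|->] /=.
  exact: h2. exact: h1.
Qed.

(** The norm that MathComp-Analysis puts on ['rV[R]_n] is the sup norm. *)
Definition enorm (R : realType) n (x : 'rV[R]_n) : R :=
  Num.sqrt (\sum_(i < n) x ord0 i ^+ 2).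

Section multi_index.
Variable n : nat.
Implicit Type a : 'I_n -> nat.

Definition mdeg a : nat := (\sum_(i < n) a i)%N.

Definition mfact a : nat := (\prod_(i < n) (a i)`!)%N.

Definition mpow (R : realType) (y : 'rV[R]_n) a : R :=
  \prod_(i < n) y ord0 i ^+ a i.

Definition munit (i : 'I_n) : 'I_n -> nat := fun j => (j == i)%N.

End multi_index.

(** Finite index type containing all multi-indices of degree at most [k]:
    their entries are at most [k]. *)
Definition bmindex n k := {ffun 'I_n -> 'I_k.+1}.

Definition mi n k (a : bmindex n k) : 'I_n -> nat := fun i => a i.

Section weak_derivative.
Context {R : realType} {n : nat}.
Local Notation mu := (lebesgue_rV R n).
Implicit Types (u v f : 'rV[R]_n -> R) (a : 'I_n -> nat).

Definition partial (i : 'I_n) f : 'rV[R]_n -> R :=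
  fun x => 'D_(delta_mx ord0 i) f x.

Definition iter_partial (s : seq 'I_n) f : 'rV[R]_n -> R := foldr partial f s.

(** C^oo: the partial derivatives of all orders, taken in any order of the
    variables, exist and are continuous. *)
Definition smooth f := forall s : seq 'I_n,
  continuous (iter_partial s f) /\
  forall i x, derivable (iter_partial s f) x (delta_mx ord0 i).

Definition test_function f :=
  smooth f /\ compact (closure [set x | f x != 0]).

Definition mderive a f : 'rV[R]_n -> R :=
  iter_partial (flatten [seq nseq (a i) i | i <- enum 'I_n]) f.

Definition locally_integrable_rV u :=
  measurable_fun [set: 'rV[R]_n] u /\
  forall K, compact K -> mu.-integrable K (EFin \o u).

Definition is_weak_derivative a u v :=
  [/\ locally_integrable_rV u, locally_integrable_rV v &
    forall f, test_function f ->
      (\int[mu]_x (u x * mderive a f x) =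
       (-1) ^+ mdeg a * \int[mu]_x (v x * f x))%R].

Definition weakly_derivable a u := exists v, is_weak_derivative a u v.

(** [D^a u]: some weak derivative (they all agree almost everywhere), and [u]
    itself for [a = 0]. The value is irrelevant if there is none. *)
Definition wderive a u : 'rV[R]_n -> R :=
  if mdeg a == 0%N then u else xget (cst 0) [set v | is_weak_derivative a u v].

Definition wgrad u (x : 'rV[R]_n) : 'rV[R]_n :=
  \row_i wderive (munit i) u x.

End weak_derivative.

Section sobolev.
Context {R : realType} {n : nat}.
Local Notation mu := (lebesgue_rV R n).
Implicit Types (p : \bar R) (s : R) (u v : 'rV[R]_n -> R).
Local Open Scope ereal_scope.

(** On the diagonal the integrand is [0 / 0 = 0]. *)
Definition gagliardo s (r : R) v : \bar R :=
  ((s * (1 - s))%:E *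
   \int[mu]_x \int[mu]_y
     (`|v x - v y| `^ r / enorm (x - y) `^ (n%:R + s * r))%R%:E) `^ r^-1.

Definition hoelder_seminorm s v : \bar R :=
  ess_sup (mu \x mu)
    (fun z => (`|v z.1 - v z.2| / enorm (z.1 - z.2) `^ s)%R%:E).

(** [+oo] if some first-order weak derivative of [v] does not exist as a
    locally integrable function. *)
Definition grad_seminorm p v : \bar R :=
  if `[< forall i, weakly_derivable (munit i) v >]
  then 'N[mu]_p[(fun x => (enorm (wgrad v x))%:E)] else +oo.

(** Only meant for [0 <= s <= 1] and [1 <= p]. *)
Definition seminormW s p v : \bar R :=
  if s == 0%R then 'N[mu]_p[EFin \o v]
  else if s == 1%R then grad_seminorm p v
  else match p with
       | r%:E => gagliardo s r v
       | _ => hoelder_seminorm s v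
       end.

(** [0] is neutral: the seminorms are nonnegative. *)
Definition seminormWk (k : nat) s p u : \bar R :=
  \big[maxe/0]_(a : bmindex n k | mdeg (mi a) == k)
    seminormW s p (wderive (mi a) u).

Definition sobolev (k : nat) p u :=
  forall a : bmindex n k, (mdeg (mi a) <= k)%N ->
    weakly_derivable (mi a) u /\ wderive (mi a) u \in Lfun mu p.

Definition frac_sobolev (k : nat) s p u :=
  sobolev k p u /\ seminormWk k s p u < +oo.

End sobolev.

Definition taylor (R : realType) n k (u : 'rV[R]_n -> R) (x y : 'rV[R]_n) : R :=
  \sum_(a : bmindex n k | (mdeg (mi a) <= k)%N)
    wderive (mi a) u x / (mfact (mi a))%:R * mpow y (mi a).

(* Main.v *)
Require Import Defs.
From mathcomp Require Import all_boot all_order all_algebra.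
From mathcomp Require Import all_classical all_reals all_analysis.
From mathcomp Require Import measurable_realfun ess_sup_inf.
From mathcomp Require Import ring lra zify.
Import Order.TTheory GRing.Theory Num.Theory.
Import numFieldNormedType.Exports.
Local Open Scope classical_set_scope.
Local Open Scope ring_scope.
Set Implicit Arguments.
Unset Strict Implicit.
Unset Printing Implicit Defensive.

(** Two facts combine.

    Reduction to order zero. Integrating along the segment from [x] to [x + y],
    the Taylor remainder of order [k + 1] of [u] is the average over [t] in [0, 1]
    of the sum over [i] of [y_i] times the remainder of order [k] of the [i]-th
    partial derivative of [u] at the step [t y]. By Minkowski's integral inequality
    and induction ([taylor_bound]), the remainder of order [k] is bounded in [L^p] by
    [(n |y|)^k] times the largest value of the modulus
    [|| v(. + t y) - v ||_p], over [t] in [0, 1] and over the derivatives [v] of [u]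
    of order [k]. The identity behind this is the fundamental theorem of calculus
    for weak derivatives ([weak_FTC]), valid for almost every [x]. It is proved by
    testing against products of smooth one-variable functions of bounded support,
    which determine a locally integrable function almost everywhere
    ([fundamental_lemma]).

    Order zero. It remains to bound [|| v(. + y) - v ||_p] by a constant, depending
    on [n] only, times [[v]_(W^(s,p)) |y|^s]. For [s = 0] this is the triangle
    inequality ([modulus_Lnorm]), for [s = 1] again the fundamental theorem of calculus
    ([modulus_grad]). For [0 < s < 1] and finite [p], the modulus is subadditive in the
    step, so that its value at [y] bounds from below its average over the steps of
    size about [L^j |y|], for every integer [j]: for [j >= 0] because [y] is the
    difference of two such steps, for [j <= 0] after cutting [y] into [L^-j] equal
    steps. The Gagliardo integral thus dominates two geometric series, of ratios
    [L^(-s p)] and [L^(-(1 - s) p)], whose sums are of order [1 / (s p)] and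
    [1 / ((1 - s) p)]; this is exactly compensated by the factor [s (1 - s)] of the
    seminorm, so that the constant depends neither on [s] nor on [p]
    ([modulus_gagliardo]). For [p = +oo] a single scale is enough
    ([modulus_hoelder]). *)

(** * Translation invariance of Lebesgue measure *)

Section translation.
Context {R : realType}.
Local Open Scope ereal_scope.

Lemma measurable_addr (c : R) :
  measurable_fun [set: measurableTypeR R] (fun x : measurableTypeR R => (x + c)%R : measurableTypeR R).
Proof. exact: measurable_funD. Qed.

Lemma lebesgue_measure_translation (c : R) (A : set R) : measurable A ->
  lebesgue_measure ((fun x => x + c)%R @^-1` A) = lebesgue_measure A.
Proof.
move=> mA.
pose m : {measure set (measurableTypeR R) -> \bar R} :=
  measure_function_pushforward__canonical__measure_function_Measure
     (@lebesgue_measure R) (measurable_addr c).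
suff : lebesgue_measure A = m A by [].
apply: lebesgue_measure_unique => // X [[a b]] /= _ <-.
rewrite lebesgue_measure_itv/= /pushforward.
rewrite (_ : _ @^-1` _ = `](a - c)%R, (b - c)%R]%classic :> set R).
  rewrite lebesgue_measure_itv/= !lte_fin ltrD2r.
  by case: ifPn => // _; rewrite -!EFinB; congr EFin; lra.
apply/seteqP; split => x /=; rewrite !in_itv/= => /andP[? ?];
  apply/andP; split; lra.
Qed.

Lemma ge0_integral_translation_R (c : R) (f : measurableTypeR R -> \bar R) :
  measurable_fun setT f -> (forall x, 0 <= f x) ->
  \int[lebesgue_measure]_x f (x + c)%R = \int[lebesgue_measure]_x f x.
Proof.
move=> mf f0.
have := @ge0_integral_pushforward _ _ _ _ R _ (measurable_addr c) lebesgue_measure setT f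
  measurableT mf (fun x _ => f0 x).
rewrite preimage_setT => <-.
apply: eq_measure_integral => [|mc A mA _]; first exact: measurable_addr.
exact: lebesgue_measure_translation.
Qed.

(** Lebesgue measure on R^(n+1) is the image of a product under
    [rV_cons], so Tonelli lets every statement about it be proved by induction
    on the dimension. *)
Lemma ge0_integral_rV_cons n (f : 'rV[R]_n.+1 -> \bar R) :
  measurable_fun setT f -> (forall x, 0 <= f x) ->
  \int[lebesgue_rV R n.+1]_x f x =
  \int[lebesgue_measure]_a \int[lebesgue_rV R n]_v f (rV_cons (a, v)).
Proof.
move=> mf f0.
have -> : \int[lebesgue_rV R n.+1]_x f x =
   \int[lebesgue_measure \x lebesgue_rV R n]_z f (rV_cons z).
  rewrite (@ge0_integral_pushforward _ _ _ _ R _ (@measurable_rV_cons R n)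
     (lebesgue_measure \x lebesgue_rV R n) setT f measurableT mf (fun x _ => f0 x)).
  by rewrite preimage_setT.
rewrite (fubini_tonelli1 (fun z => f (rV_cons z))) //.
exact: measurableT_comp mf (@measurable_rV_cons R n).
Qed.

Lemma measurable_rV_shift n (h : 'rV[R]_n) :
  measurable_fun [set: 'rV[R]_n] (fun x : 'rV[R]_n => (x + h)%R).
Proof.
apply/measurable_fun_rVP => i; under eq_fun do rewrite mxE.
by apply: measurable_funD => //; exact: measurable_coord.
Qed.

Lemma ge0_integral_translation n (h : 'rV[R]_n) (f : 'rV[R]_n -> \bar R) :
  measurable_fun setT f -> (forall x, 0 <= f x) ->
  \int[lebesgue_rV R n]_x f (x + h)%R = \int[lebesgue_rV R n]_x f x.
Proof.
elim: n h f => [|n IH] h f mf f0.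
  by apply: eq_integral => x _; congr f; rewrite !thinmx0.
have mfc := measurableT_comp mf (@measurable_rV_cons R n).
rewrite !ge0_integral_rV_cons //; last first.
  exact: measurableT_comp mf (@measurable_rV_shift _ h).
pose h' : 'rV[R]_n := (\row_j h ord0 (lift ord0 j))%R.
pose F a := \int[lebesgue_rV R n]_v f (rV_cons (a, v)).
rewrite -[RHS](@ge0_integral_translation_R (h ord0 ord0) F); last first.
- by move=> x; exact: integral_ge0.
- exact: (measurable_fun_fubini_tonelli_F (fun z => f (rV_cons z))).
apply: eq_integral => a _; rewrite /F.
rewrite -[RHS](IH h'); last 2 first.
- by apply: measurableT_comp mfc _; exact: measurable_pair1.
- by [].
apply: eq_integral => v _; congr f; apply/rowP => i.
rewrite /rV_cons !mxE; case: (unliftP ord0 i) => [j|] -> /=; by rewrite ?mxE.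
Qed.

End translation.

Section translation2.
Context {R : realType}.
Local Open Scope ereal_scope.

Lemma integral_translation n (h : 'rV[R]_n) (f : 'rV[R]_n -> \bar R) :
  measurable_fun setT f ->
  \int[lebesgue_rV R n]_x f (x + h)%R = \int[lebesgue_rV R n]_x f x.
Proof.
move=> mf; rewrite [LHS]integralE [RHS]integralE.
rewrite (funepos_comp f (fun x => x + h)%R) (funeneg_comp f (fun x => x + h)%R).
congr (_ - _).
- by rewrite (ge0_integral_translation h (f := f^\+)) //; exact: measurable_funepos.
- by rewrite (ge0_integral_translation h (f := f^\-)) //; exact: measurable_funeneg.
Qed.

Lemma ae_translation n (h : 'rV[R]_n) (P : 'rV[R]_n -> Prop) :
  {ae lebesgue_rV R n, forall x, P x} ->
  {ae lebesgue_rV R n, forall x, P (x + h)%R}.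
Proof.
move=> [A [mA A0 PA]]; exists ((fun x => (x + h)%R) @^-1` A); split.
- by rewrite -[X in measurable X]setTI; exact: measurable_rV_shift.
- have mS : measurable ((fun x => (x + h)%R) @^-1` A).
    by rewrite -[X in measurable X]setTI; exact: measurable_rV_shift.
  have muE B : measurable B -> lebesgue_rV R n B = \int[lebesgue_rV R n]_x (\1_B x)%:E.
    by move=> mB; rewrite integral_indic// setIT.
  rewrite muE// -A0 (muE A)//.
  rewrite -[RHS](ge0_integral_translation h (f := fun x => (\1_A x)%:E))//.
    by apply/measurable_EFinP; exact: measurable_indic.
- by move=> x /= nP; exact: PA.
Qed.

Lemma integrable_translation n (h : 'rV[R]_n) (f : 'rV[R]_n -> \bar R) :
  (lebesgue_rV R n).-integrable setT f ->
  (lebesgue_rV R n).-integrable setT (fun x => f (x + h)%R).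
Proof.
move=> /integrableP[mf foo]; apply/integrableP; split.
  exact: measurableT_comp mf (measurable_rV_shift h).
rewrite (ge0_integral_translation h (f := fun x => `|f x|)) //.
exact: measurableT_comp.
Qed.

Lemma Lnorm_translation n (h : 'rV[R]_n) p (f : 'rV[R]_n -> \bar R) :
  1 <= p -> measurable_fun setT f ->
  'N[lebesgue_rV R n]_p[(fun x => f (x + h)%R)] = 'N[lebesgue_rV R n]_p[f].
Proof.
move=> p1 mf; rewrite unlock; case: p p1 => [r _|_|//].
- congr (_ `^ _).
  rewrite (ge0_integral_translation h (f := fun x => `|f x| `^ r)) //; last first.
    by move=> x; exact: poweR_ge0.
  apply: (measurableT_comp (measurable_poweR r)) => //.
  exact: measurableT_comp.
- case: (0 < lebesgue_rV R n setT) => //.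
  have le_tr (g : 'rV[R]_n -> \bar R) k :
      ess_sup (lebesgue_rV R n) (fun x => g (x + k)%R) <= ess_sup (lebesgue_rV R n) g.
    by apply/ess_supP; apply: (@ae_translation _ k (fun x => g x <= _)); exact: ess_sup_ge.
  apply/eqP; rewrite eq_le; apply/andP; split; first exact: (le_tr (abse \o f) h).
  have := le_tr (fun x => abse (f (x + h)%R)) (- h)%R.
  rewrite (_ : (fun x => abse (f (x - h + h)%R)) = abse \o f) //.
  by apply/funext => x; rewrite subrK.
Qed.

End translation2.

(** * Norms of Lebesgue spaces *)

Lemma lee_poweR {R : realType} (r : R) (x y : \bar R) : 0 <= r ->
  (0 <= x -> x <= y -> x `^ r <= y `^ r)%E.
Proof.
move=> r0 x0 xy; apply: gt0_ler_poweR => //.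
- by rewrite in_itv/= x0 leey.
- by rewrite in_itv/= (le_trans x0 xy) leey.
Qed.

Section Lnorm_extra.
Context d (T : measurableType d) {R : realType} (mu : {measure set T -> \bar R}).
Implicit Types (p : \bar R) (f g : T -> R).
Local Open Scope ereal_scope.
Local Notation "'N_ p [ f ]" := (Lnorm mu p (EFin \o f)).

Lemma ae_le_Lnorm p f g : 1 <= p ->
  measurable_fun setT f -> measurable_fun setT g ->
  {ae mu, forall x, (`|f x| <= `|g x|)%R} -> 'N_p[f] <= 'N_p[g].
Proof.
move=> p1 mf mg fg; rewrite unlock; case: p p1 => [r r1|_|//].
- have r0 : (0 <= r)%R by rewrite -lee_fin; exact: le_trans r1.
  apply: lee_poweR; rewrite ?invr_ge0//.
    by apply: integral_ge0 => x _; exact: poweR_ge0.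
  apply: ae_ge0_le_integral => //; [by move=> *; exact: poweR_ge0| |by move=> *; exact: poweR_ge0| |].
  + apply: (measurableT_comp (measurable_poweR r)) => //.
    by apply: measurableT_comp => //; exact/measurable_EFinP.
  + apply: (measurableT_comp (measurable_poweR r)) => //.
    by apply: measurableT_comp => //; exact/measurable_EFinP.
  + apply: filterS fg => x fg _.
    by apply: lee_poweR; rewrite ?lee_fin.
- case: ifPn => // mu0; apply: le_ess_sup; apply: filterS fg => x /=.
  by rewrite lee_fin.
Qed.

Lemma Lnorm_scale p (c : R) f : 1 <= p -> measurable_fun setT f ->
  'N_p[(fun x => c * f x)%R] = `|c|%:E * 'N_p[f].
Proof.
move=> p1 mf; rewrite unlock; case: p p1 => [r r1|_|//].
- have r0 : (0 < r)%R by rewrite -lte_fin; exact: lt_le_trans r1.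
  under eq_integral => x _ do
    rewrite /= normrM powRM// EFinM.
  rewrite ge0_integralZl//.
  + rewrite poweRM ?lee_fin ?powR_ge0 ?integral_ge0//.
    by rewrite -poweR_EFin -poweRrM mulfV ?gt_eqF// poweRe1.
  + apply/measurable_EFinP; apply: (measurableT_comp (measurable_powR r)).
    exact: measurableT_comp.
- case: ifPn => mu0; last by rewrite mule0.
  rewrite -ess_supZl//; apply: eq_ess_sup; apply: nearW => x /=.
  by rewrite normrM.
Qed.

Lemma Lnorm_sum p (I : Type) (r : seq I) (F : I -> T -> R) : 1 <= p ->
  (forall i, measurable_fun setT (F i)) ->
  'N_p[(fun x => \sum_(i <- r) F i x)%R] <= \sum_(i <- r) 'N_p[F i].
Proof.
move=> p1 mF; elim: r => [|i r IH].
  rewrite big_nil (_ : _ \o _ = cst 0); last first.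
    by apply/funext => x /=; rewrite big_nil.
  by rewrite Lnorm0 //; apply: contraTneq p1 => ->; rewrite -ltNge lte01.
rewrite big_cons; apply: le_trans (leeD (le_refl _) IH).
rewrite (_ : (fun x => _) = (F i \+ (fun x => \sum_(j <- r) F j x))%R); last first.
  by apply/funext => x; rewrite big_cons.
by apply: eminkowski => //; exact: measurable_sum.
Qed.

End Lnorm_extra.

Section integral_minkowski.
Context d1 d2 (T1 : measurableType d1) (T2 : measurableType d2) {R : realType}.
Variables (mu : {sigma_finite_measure set T1 -> \bar R}) (P : probability T2 R).
Local Open Scope ereal_scope.

(** Hoelder's inequality against the constant 1, whose norm is 1 under a
    probability. *)
Lemma jensen_poweR (f : T2 -> R) (r : R) : (1 <= r)%R -> measurable_fun setT f ->
  (\int[P]_t `|(f t)%:E|) `^ r <= \int[P]_t (`|(f t)%:E| `^ r).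
Proof.
move=> r1 mf; have r0 : (0 < r)%R by exact: lt_le_trans r1.
rewrite -(poweR_Lnorm P (EFin \o f)) ?gt_eqF//.
apply: lee_poweR; [exact: ltW|by apply: integral_ge0|].
rewrite -(Lnorm1 P (EFin \o f)).
move: r1; rewrite le_eqVlt => /predU1P[<-//|r1].
have q0 : (0 < 1 - r^-1)%R by rewrite subr_gt0 invf_lt1.
have := @hoelder _ _ _ P f (cst 1%R) r (1 - r^-1)^-1 mf (measurable_cst _) r0.
rewrite invr_gt0 q0 invrK addrC subrK => /(_ isT erefl).
rewrite (_ : (f \* cst 1)%R = f); last by apply/funext => x /=; rewrite mulr1.
rewrite (_ : EFin \o cst 1%R = cst 1) //.
rewrite Lnorm_cst1 [X in _ * X `^ _](@probability_setT _ _ _ P).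
by rewrite poweR1r mule1.
Qed.

(** Minkowski's integral inequality, in the form used for remainders written
    as averages over a segment. For finite [p] it is Jensen in the inner variable
    followed by Tonelli. For [p = +oo] the positive part of [|F| - M] has null
    integral in one order of integration, hence in the other, so that almost
    every inner average is at most [M]; this avoids exchanging quantifiers over
    null sets by hand. *)
Lemma Lnorm_integral_le p (M : R) (F : T1 * T2 -> R) (g : T1 -> R) :
  1 <= p -> (0 <= M)%R -> measurable_fun setT F -> measurable_fun setT g ->
  {ae P, forall t, 'N[mu]_p[EFin \o (fun x => F (x, t))] <= M%:E} ->
  {ae mu, forall x, `|(g x)%:E| <= \int[P]_t `|(F (x, t))%:E|} ->
  'N[mu]_p[EFin \o g] <= M%:E.
Proof.
move=> p1 M0 mF mg FM gF.
have mF1 x : measurable_fun setT (fun t => F (x, t)).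
  exact: measurableT_comp mF (measurable_pair1 _).
have mF2 t : measurable_fun setT (fun x => F (x, t)).
  exact: measurableT_comp mF (measurable_pair2 _).
case: p p1 FM => [r r1|_|//] FM.
- have r0 : (0 < r)%R by rewrite -lte_fin; exact: lt_le_trans r1.
  have E (x : \bar R) : 0 <= x -> x = (x `^ r) `^ r^-1.
    by move=> x0; rewrite -poweRrM mulfV ?gt_eqF// poweRe1.
  rewrite (E _ (Lnorm_ge0 _ _ _)) poweR_Lnorm ?gt_eqF//.
  rewrite [leRHS]E ?lee_fin//; apply: lee_poweR.
  + by rewrite invr_ge0 ltW.
  + by apply: integral_ge0 => x _; exact: poweR_ge0.
  pose G (z : T1 * T2) := `|(F z)%:E| `^ r.
  have mG : measurable_fun setT G.
    apply: (measurableT_comp (measurable_poweR r)) => //.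
    by apply: measurableT_comp => //; exact/measurable_EFinP.
  have G0 z : 0 <= G z by exact: poweR_ge0.
  apply: (@le_trans _ _ (\int[mu]_x \int[P]_t G (x, t))).
    apply: ae_ge0_le_integral => //.
    + by move=> *; exact: poweR_ge0.
    + apply: (measurableT_comp (measurable_poweR r)) => //.
      by apply: measurableT_comp => //; exact/measurable_EFinP.
    + by move=> *; exact: integral_ge0.
    + exact: measurable_fun_fubini_tonelli_F.
    apply: filterS gF => x gF _; apply: le_trans (jensen_poweR _ (mF1 x)) => //.
    by apply: lee_poweR => //; exact: ltW.
  rewrite fubini_tonelli//.
  apply: (@le_trans _ _ (\int[P]_t (M%:E `^ r))).
    apply: ae_ge0_le_integral => //.
    + by move=> *; exact: integral_ge0.
    + exact: measurable_fun_fubini_tonelli_G.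
    + by move=> *; exact: poweR_ge0.
    apply: filterS FM => t FM _.
    rewrite -(poweR_Lnorm mu (EFin \o (fun x => F (x, t)))) ?gt_eqF//.
    apply: lee_poweR; [exact: ltW|exact: Lnorm_ge0|exact: FM].
  by rewrite integral_cst// [X in _ * X](@probability_setT _ _ _ P) mule1.
- move: FM; rewrite unlock; case: ifPn => [mu0|_ _]; last by rewrite lee_fin.
  move=> FM.
  pose G (z : T1 * T2) := maxe (`|(F z)%:E| - M%:E) 0.
  have mG : measurable_fun setT G.
    apply: measurable_maxe => //; apply: emeasurable_funB => //.
    by apply: measurableT_comp => //; exact/measurable_EFinP.
  have G0 z : 0 <= G z by rewrite /G le_max lexx orbT.
  have : \int[mu]_x \int[P]_t G (x, t) = 0.
    rewrite fubini_tonelli//.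
    rewrite (ae_eq_integral (cst 0)) ?integral0//.
      exact: measurable_fun_fubini_tonelli_G.
    apply: filterS FM => t FM _ /=.
    rewrite (ae_eq_integral (cst 0)) ?integral0//.
      exact: measurableT_comp mG (measurable_pair2 _).
    have /ess_supP := FM; apply: filterS => x /= FxM _.
    by apply/max_idPr; rewrite leeBlDr// add0e.
  rewrite [X in X = _](_ : _ = \int[mu]_x `|\int[P]_t G (x, t)|); last first.
    by apply: eq_integral => x _; rewrite gee0_abs// integral_ge0.
  move=> /ae_eq_integral_abs => /(_ measurableT).
  move=> /(_ (measurable_fun_fubini_tonelli_F _ _ _)) GF.
  have {}GF := GF mG G0.
  apply/ess_supP; move: gF GF; apply: filterS2 => x gF /(_ I) G0x.
  apply: (le_trans gF).
  apply: (@le_trans _ _ (\int[P]_t (M%:E + G (x, t)))).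
    apply: ge0_le_integral => //.
    + by apply: measurableT_comp => //; exact/measurable_EFinP.
    + by apply: emeasurable_funD => //; exact: measurableT_comp mG (measurable_pair1 _).
    + by move=> t _; rewrite -leeBlDl// /G le_max lexx.
  rewrite ge0_integralD//; last exact: measurableT_comp mG (measurable_pair1 _).
  by rewrite G0x adde0 integral_cst// [X in _ * X](@probability_setT _ _ _ P) mule1.
Qed.

End integral_minkowski.

(** * Smooth functions of one variable *)

Section smooth1.
Context {R : realType}.
Implicit Types f g : R -> R.

(** Differentiability [m] times, by recursion on the derivative: products and
    affine substitutions are then handled by induction on [m], with no Leibniz
    formula. *)
Fixpoint ndiff (m : nat) f : Prop :=
  if m is m'.+1 then (forall x, derivable f x 1) /\ ndiff m' (derive1 f) else True.

Definition smooth1 f := forall m, ndiff m f.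

Lemma ndiffS m f : ndiff m.+1 f -> ndiff m f.
Proof. by elim: m f => [//|m IH] f [df /IH]. Qed.

Lemma ndiff_cst m (c : R) : ndiff m (cst c).
Proof.
elim: m c => [//|m IH] c; split=> [x|]; first exact: derivable_cst.
rewrite (_ : derive1 _ = cst 0); first exact: IH.
by apply/funext => x; rewrite derive1E derive_cst.
Qed.

Lemma ndiffD m f g : ndiff m f -> ndiff m g -> ndiff m (f + g).
Proof.
elim: m f g => [//|m IH] f g [df ndf] [dg ndg].
split=> [x|]; first exact: derivableD.
rewrite (_ : derive1 _ = (derive1 f) + (derive1 g)); first exact: IH.
apply/funext => x; change (derive1 (f + g) x = derive1 f x + derive1 g x).
by rewrite !derive1E deriveD.
Qed.

Lemma ndiffM m f g : ndiff m f -> ndiff m g -> ndiff m (f * g).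
Proof.
elim: m f g => [//|m IH] f g df dg.
have [df1 df2] := df; have [dg1 dg2] := dg.
split=> [x|]; first exact: derivableM.
rewrite (_ : derive1 _ = f * (derive1 g) + g * (derive1 f)).
  by apply: ndiffD; apply: IH => //; exact: ndiffS.
apply/funext => x.
change (derive1 (f * g) x = f x * derive1 g x + g x * derive1 f x).
by rewrite !derive1E deriveM.
Qed.

Lemma ndiffX m f k : ndiff m f -> ndiff m (f ^+ k).
Proof.
move=> df; elim: k => [|k IH]; first by rewrite expr0; exact: ndiff_cst.
by rewrite exprS; exact: ndiffM.
Qed.

Lemma ndiff_affine m f (c d : R) : ndiff m f -> ndiff m (fun x => f (c * x + d)).
Proof.
have da x : is_derive x (1:R) (fun x : R => c * x + d) c.
  have := is_deriveD (is_deriveZ c (is_derive_id x (1:R))) (is_derive_cst d x (1:R)).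
  by rewrite addr0 [c *: _]mulr1.
elim: m f => [//|m IH] f [df ndf].
have dc x : is_derive x (1:R) (fun x => f (c * x + d)) ((derive1 f) (c * x + d) * c).
  apply: (@is_derive1_comp _ f (fun x : R => c * x + d)) => //.
  by rewrite derive1E; apply: derivableP.
split=> [x|]; first by case: (dc x).
rewrite (_ : derive1 _ = (fun x => (derive1 f) (c * x + d)) * cst c).
  by apply: ndiffM; [exact: IH|exact: ndiff_cst].
by apply/funext => x; rewrite derive1E (@derive_val _ _ _ _ _ _ _ (dc x)).
Qed.

Lemma smooth1_derive f : smooth1 f -> smooth1 (derive1 f).
Proof. by move=> sf m; case: (sf m.+1). Qed.

Lemma smooth1_derive1n f k : smooth1 f -> smooth1 (derive1n k f).
Proof.
by move=> sf; elim: k => [//|k IH]; rewrite derive1nS; exact: smooth1_derive.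
Qed.

Lemma smooth1_derivable f x : smooth1 f -> derivable f x 1.
Proof. by move=> /(_ 1%N)[]. Qed.

Lemma smooth1_continuous f : smooth1 f -> continuous f.
Proof.
move=> sf x; apply: differentiable_continuous.
by apply/derivable1_diffP; exact: smooth1_derivable.
Qed.

(** The derivative of [x^-m exp(-1/x)] is a combination of functions of the
    same shape; carrying [m] makes the family closed under differentiation, which
    is all that smoothness requires. *)
Definition flat_exp (m : nat) (x : R) : R :=
  if 0 < x then x^-1 ^+ m * expR (- x^-1) else 0.

Lemma flat_exp_ge0 m x : 0 <= flat_exp m x.
Proof.
rewrite /flat_exp; case: ifPn => // x0.
by rewrite mulr_ge0 ?expR_ge0// exprn_ge0// invr_ge0 ltW.
Qed.

(** With [y = 1/x] this is [y^(m+1) <= (m+1)! exp y], one term of the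
    exponential series. Applied at [m + 1] it bounds the difference quotient of
    [flat_exp m] at [0] by a multiple of the increment. *)
Lemma flat_exp_le m x : 0 <= x -> flat_exp m x <= m.+1`!%:R * x.
Proof.
rewrite le_eqVlt => /predU1P[<-|x0]; first by rewrite /flat_exp ltxx mulr0.
rewrite /flat_exp x0 expRN ler_pdivrMr ?expR_gt0//.
have y0 : 0 <= x^-1 by rewrite invr_ge0 ltW.
have fac0 : (0 : R) < m.+1`!%:R by rewrite ltr0n fact_gt0.
have : x^-1 ^+ m.+1 <= m.+1`!%:R * expR x^-1.
  rewrite -ler_pdivrMl// mulrC; apply: le_trans (expR_ge1Dxn m y0).
  by rewrite lerDr.
rewrite exprSr ler_pdivrMr// => /le_trans; apply.
by rewrite mulrAC.
Qed.

Lemma is_derive_flat_exp m (x : R) :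
  is_derive x (1:R) (flat_exp m) (flat_exp m.+2 x - m%:R * flat_exp m.+1 x).
Proof.
have [x0|x0|->] := ltgtP x 0.
- rewrite [X in is_derive _ _ _ X](_ : _ = 0); last first.
    by rewrite /flat_exp ltNge (ltW x0)/= mulr0 subr0.
  apply: (@near_eq_is_derive R R R (cst 0)).
  near=> z; rewrite /flat_exp ltNge ifF//; apply/negbF/ltW; near: z.
  exact: lt_nbhsl.
- have xN0 : x != 0 by rewrite gt_eqF.
  have dV := @is_deriveV _ id x 1 1 xN0 (is_derive_id x (1:R)).
  have dX := is_deriveX m dV.
  have dE := @is_derive1_comp R expR (fun z => - z^-1) x _ _
    (is_derive_expR (- x^-1)) (is_deriveN dV).
  have dF : is_derive x (1:R) (fun z => z^-1 ^+ m * expR (- z^-1))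
      (flat_exp m.+2 x - m%:R * flat_exp m.+1 x).
    have := is_deriveM dX dE; set l := (X in is_derive _ _ _ X -> _).
    rewrite (_ : l = flat_exp m.+2 x - m%:R * flat_exp m.+1 x).
      by rewrite [X in is_derive _ _ X _ -> _](_ : _ = (fun z => z^-1 ^+ m * expR (- z^-1)))//;
        apply/funext => z; rewrite !fctE.
    rewrite /l /flat_exp x0 /= !fctE.
    case: m {dX l} => [|m] /=.
      by rewrite !expr0 !mul0r scale0r /GRing.scale/=; field.
    by rewrite /GRing.scale/= !exprS; field.
  apply: (near_eq_is_derive _ dF).
  near=> z; rewrite /flat_exp ifT//; near: z.
  exact: lt_nbhsr.
- rewrite [X in is_derive _ _ _ X](_ : _ = 0); last first.
    by rewrite /flat_exp ltxx mulr0 subr0.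
  have : (fun h => h^-1 *: ((flat_exp m \o shift 0) (h *: 1) - flat_exp m 0)) @ 0^' --> (0:R).
    apply/cvgr0Pnorm_le => e e0; near=> h.
    have h0 : h != 0 by near: h; exact: nbhs_dnbhs_neq.
    rewrite /= addr0 [h *: 1]mulr1 [flat_exp m 0]/flat_exp ltxx subr0 normrM normfV.
    rewrite /flat_exp; case: ifPn => hp; last by rewrite normr0 mulr0 ltW.
    rewrite (ger0_norm (ltW hp)) ger0_norm; last first.
      by rewrite mulr_ge0 ?expR_ge0// exprn_ge0// invr_ge0 ltW.
    rewrite mulrA -exprS.
    have := @flat_exp_le m.+1 h (ltW hp); rewrite {1}/flat_exp hp => /le_trans; apply.
    rewrite -ler_pdivlMl ?ltr0n ?fact_gt0// (le_trans (ler_norm _))//.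
    rewrite mulrC; near: h; apply: dnbhs0_le.
    by rewrite divr_gt0// ltr0n fact_gt0.
  move=> cv; apply: DeriveDef; last exact: cvg_lim cv.
  by apply/cvg_ex; exists 0.
Unshelve. all: by end_near. Qed.

Lemma ndiff_flat_exp m k : ndiff m (flat_exp k).
Proof.
elim: m k => [//|m IH] k; split=> [x|]; first by case: (is_derive_flat_exp k x).
rewrite (_ : derive1 _ = flat_exp k.+2 + (cst (- k%:R) * flat_exp k.+1)).
  by apply: ndiffD => //; apply: ndiffM => //; exact: ndiff_cst.
apply/funext => x.
by rewrite derive1E (@derive_val _ _ _ _ _ _ _ (is_derive_flat_exp k x)) !fctE mulNr.
Qed.

Definition bounded_support f := exists r, forall x, r < `|x| -> f x = 0.

Lemma bounded_support_derive f : bounded_support f -> bounded_support (derive1 f).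
Proof.
move=> [r fr]; exists r => x rx; rewrite derive1E.
rewrite (@near_eq_derive _ _ _ _ (cst 0)) ?derive_cst//.
have : nbhs x [set z | r < `|z|].
  apply: open_nbhs_nbhs; split => //.
  apply: (@open_comp _ _ (fun z : R => `|z|) [set t | r < t]) => [z _|]; last exact: open_gt.
  exact: norm_continuous.
by apply: filterS => z /= rz; rewrite fr.
Qed.

Definition test1 f := smooth1 f /\ bounded_support f.

Lemma test1_derive1n f k : test1 f -> test1 (derive1n k f).
Proof.
move=> [sf bf]; split; first exact: smooth1_derive1n.
by elim: k => [//|k IH]; rewrite derive1nS; exact: bounded_support_derive.
Qed.

(** If [0 <= psi <= 1] is a bump positive exactly on [(a, b)], then
    [1 - (1 - psi)^j] is again a bump and increases to the indicator of [(a, b)];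
    no rescaling or convolution is needed. *)
Lemma cutoff (a b : R) : exists phi : nat -> R -> R,
  [/\ forall j, test1 (phi j),
    forall j x, 0 <= phi j x <= \1_(`]a, b[%classic) x &
    forall x, phi ^~ x @ \oo --> (\1_(`]a, b[%classic) x : R)].
Proof.
pose psi x := flat_exp 0 (1 * x + - a) * flat_exp 0 (-1 * x + b).
have psi0 x : 0 <= psi x by rewrite mulr_ge0 ?flat_exp_ge0.
have flat1 x : flat_exp 0 x <= 1.
  rewrite /flat_exp; case: ifPn => // x0; rewrite expr0 mul1r.
  by rewrite -expR0 ler_expR oppr_le0 invr_ge0 ltW.
have psi1 x : psi x <= 1 by rewrite mulr_ile1 ?flat_exp_ge0.
have psiE x : (0 < psi x) = (a < x < b).
  rewrite /psi /flat_exp !expr0 !mul1r mulN1r subr_gt0 [_ + b]addrC subr_gt0.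
  case: (a < x); case: (x < b); rewrite ?mulr0 ?mul0r ?ltxx//.
  by rewrite mulr_gt0 ?expR_gt0.
have spsi m : ndiff m psi.
  by apply: (@ndiffM m (fun x => flat_exp 0 (1 * x + - a)) (fun x => flat_exp 0 (-1 * x + b)));
    apply: ndiff_affine; exact: ndiff_flat_exp.
have psi_out x : ~~ (a < x < b) -> psi x = 0.
  by rewrite -psiE -leNgt => h; apply/eqP; rewrite eq_le h psi0.
exists (fun j x => 1 - (1 - psi x) ^+ j); split.
- move=> j; split.
    move=> m.
    rewrite (_ : (fun x => _) = cst 1 + cst (-1) * (cst 1 + cst (-1) * psi) ^+ j).
      by do 2 (apply: ndiffD; first exact: ndiff_cst;
        apply: ndiffM; [exact: ndiff_cst| try apply: ndiffX]).
    by apply/funext => x; rewrite !fctE /= !mulN1r.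
  exists (`|a| + `|b|) => x abx; rewrite psi_out ?subr0 ?expr1n ?subrr//.
  apply/negP => /andP[ax xb].
  have := ler_norm a; have := ler_norm b; have := ler_norm (- a); have := ler_norm (- b).
  rewrite !normrN => *.
  have : `|x| <= `|a| + `|b| by rewrite ler_norml; apply/andP; split; lra.
  by rewrite leNgt abx.
- move=> j x; have p0 : 0 <= 1 - psi x by rewrite subr_ge0.
  have p1 : (1 - psi x) ^+ j <= 1 by rewrite exprn_ile1// gerBl.
  rewrite subr_ge0 p1 indicE; have [xab|xab] := boolP (x \in _).
    by rewrite gerBl exprn_ge0.
  rewrite psi_out ?subr0 ?expr1n ?subrr ?lexx//.
  by move: xab; rewrite notin_setE/= in_itv => /negP.
- move=> x; rewrite indicE; have [xab|xab] := boolP (x \in _).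
    have xab' : 0 < psi x by rewrite psiE; move: xab; rewrite inE/= in_itv.
    rewrite -[X in _ --> X]subr0; apply: cvgB; first exact: cvg_cst.
    apply: cvg_expr; rewrite ger0_norm ?subr_ge0// ltrBlDr.
    by rewrite ltrDl.
  rewrite psi_out; last by move: xab; rewrite notin_setE/= in_itv => /negP.
  under eq_fun do rewrite subr0 expr1n subrr.
  exact: cvg_cst.
Qed.

End smooth1.

(** * Tensor products as test functions *)

Section tensor.
Context {R : realType} {n : nat}.
Implicit Types (phi : 'I_n -> R -> R) (s : seq 'I_n) (a : 'I_n -> nat).

(** Products of one-variable functions suffice as test functions. Their mixed
    derivatives are products of one-variable derivatives, so that the order of
    differentiation is immaterial without the symmetry of second derivatives. *)
Definition tensor phi : 'rV[R]_n -> R := fun x => \prod_(i < n) phi i (x ord0 i).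

Definition tensor_derive a phi : 'I_n -> R -> R := fun i => derive1n (a i) (phi i).

Definition tensor_test phi := forall i, test1 (phi i).

Lemma tensor_test_derive a phi : tensor_test phi -> tensor_test (tensor_derive a phi).
Proof. by move=> tphi i; exact: test1_derive1n. Qed.

(** Along a coordinate line only one factor moves, hence the difference
    quotient is the one of that factor times a constant. *)
Lemma is_derive_tensor phi i x : tensor_test phi ->
  is_derive x (delta_mx ord0 i) (tensor phi) (tensor (tensor_derive (munit i) phi) x).
Proof.
move=> tphi.
pose c := \prod_(j < n | j != i) phi j (x ord0 j).
have E : (fun h : R => h^-1 *: ((tensor phi \o shift x) (h *: delta_mx ord0 i) - tensor phi x)) =
    (fun h => (h^-1 *: ((phi i \o shift (x ord0 i)) (h *: 1) - phi i (x ord0 i))) * c).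
  apply/funext => h; rewrite /= /tensor (bigD1 i)//= [X in _ - X](bigD1 i)//=.
  rewrite !mxE !eqxx /= mulr1 [h *: 1]mulr1 /c.
  rewrite (eq_bigr (fun j => phi j (x ord0 j))); last first.
    by move=> j ji; rewrite !mxE eqxx /= (negbTE ji) mulr0 add0r.
  by rewrite -mulrBl -scalerAl.
have d1 : derivable (phi i) (x ord0 i) 1 by apply: smooth1_derivable; case: (tphi i).
have cv : (fun h : R => h^-1 *: ((tensor phi \o shift x) (h *: delta_mx ord0 i) - tensor phi x)) @ 0^'
    --> tensor (tensor_derive (munit i) phi) x.
  rewrite E; rewrite [X in _ --> X](_ : _ = derive1 (phi i) (x ord0 i) * c).
    by apply: cvgM; [rewrite derive1E; exact: d1|exact: cvg_cst].
  rewrite /tensor (bigD1 i)//= /tensor_derive /munit eqxx derive1n1; congr (_ * _).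
  by apply: eq_bigr => j ji; rewrite (negbTE ji).
apply: DeriveDef; last exact: cvg_lim cv.
by apply/cvg_ex; exists (tensor (tensor_derive (munit i) phi) x).
Qed.

Lemma partial_tensor phi i : tensor_test phi ->
  partial i (tensor phi) = tensor (tensor_derive (munit i) phi).
Proof.
by move=> tphi; apply/funext => x; rewrite /partial (@derive_val _ _ _ _ _ _ _ (is_derive_tensor i x tphi)).
Qed.

Lemma iter_partial_tensor phi s : tensor_test phi ->
  iter_partial s (tensor phi) = tensor (tensor_derive (fun i => count_mem i s) phi).
Proof.
move=> tphi; elim: s => [|i s IH] /=.
  by congr tensor; apply/funext => i.
rewrite IH partial_tensor; last exact: tensor_test_derive.
congr tensor; apply/funext => j; rewrite /tensor_derive /munit /= eq_sym.
by case: eqP.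
Qed.

Lemma mderive_tensor a phi : tensor_test phi ->
  mderive a (tensor phi) = tensor (tensor_derive a phi).
Proof.
move=> tphi; rewrite /mderive iter_partial_tensor//; congr (tensor (tensor_derive _ _)).
apply/funext => i; rewrite count_flatten -map_comp sumnE big_map big_enum/=.
rewrite (bigD1 i)//= count_nseq/= eqxx mul1n big1 ?addn0// => j ji.
by rewrite count_nseq/= (negbTE ji).
Qed.

Lemma continuous_tensor phi : tensor_test phi -> continuous (tensor phi).
Proof.
move=> tphi; rewrite /tensor.
elim: (index_enum 'I_n) => [|i r IH] x.
  rewrite (_ : (fun x => _) = cst 1); first apply: cst_continuous.
  by apply/funext => z; rewrite big_nil.
rewrite (_ : (fun x => _) = (fun z : 'rV[R]_n => phi i (z ord0 i) *
    \prod_(j <- r) phi j (z ord0 j))); last first.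
  by apply/funext => z; rewrite big_cons.
apply: cvgM; [exact: nbhs_filter| |exact: IH].
have h : {for x, continuous (phi i \o (fun z : 'rV[R]_n => z ord0 i))}; last exact: h.
apply: continuous_comp; first exact: coord_continuous.
by apply: smooth1_continuous; case: (tphi i).
Qed.

Lemma test_function_tensor phi : tensor_test phi -> test_function (tensor phi).
Proof.
move=> tphi; split.
  move=> s; rewrite iter_partial_tensor//.
  have ts := tensor_test_derive (fun i => count_mem i s) tphi.
  split; first exact: continuous_tensor.
  by move=> i x; case: (is_derive_tensor i x ts).
have /choice[r rP] : forall i, exists r, forall x, r < `|x| -> phi i x = 0.
  by move=> i; case: (tphi i).
apply: (@subclosed_compact _ _ [set x : 'rV[R]_n | forall i, `[- (r i), r i]%classic (x ord0 i)]).
- exact: closed_closure.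
- by apply: (@rV_compact R n (fun i => `[- (r i), r i]%classic)) => i; exact: segment_compact.
- have cB : closed [set x : 'rV[R]_n | forall i, `[- (r i), r i]%classic (x ord0 i)].
    apply: compact_closed; first exact: norm_hausdorff.
    by apply: (@rV_compact R n (fun i => `[- (r i), r i]%classic)) => i; exact: segment_compact.
  rewrite closureE; apply: smallest_sub => // x /= tx i.
  rewrite in_itv /= -ler_norml leNgt; apply/negP => /rP phi0.
  by move: tx; rewrite /tensor (bigD1 i)//= phi0 mul0r eqxx.
Qed.

Lemma measurable_tensor phi : tensor_test phi -> measurable_fun setT (tensor phi).
Proof.
move=> tphi; apply: measurable_prod => i _.
apply: (measurableT_comp _ (measurable_coord i)).
by apply: continuous_measurable_fun; apply: smooth1_continuous; case: (tphi i).
Qed.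

Lemma test1_bounded (f : R -> R) : test1 f -> exists M, forall x, `|f x| <= M.
Proof.
move=> [sf [r rf]].
have cnf : {within `[- `|r|, `|r|], continuous (fun x => `|f x|)}.
  apply: continuous_subspaceT => x; apply: (@continuous_comp _ _ _ f).
    exact: smooth1_continuous.
  exact: norm_continuous.
have [|c _ cM] := EVT_max _ cnf; first by rewrite ge0_cp// ?lerNl.
exists `|f c| => x.
have [xr|rx] := leP `|x| `|r|; first by apply: cM; rewrite in_itv/= -ler_norml.
by rewrite rf ?normr0//; apply: le_lt_trans rx; exact: ler_norm.
Qed.

(** Closed balls of the sup norm. They exhaust the space, are compact, and
    are visibly measurable for the product sigma-algebra. *)
Definition cube (r : R) : set 'rV[R]_n :=
  [set x | forall i, `[- r, r]%classic (x ord0 i)].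

Lemma cube_compact r : compact (cube r).
Proof.
by apply: (@rV_compact R n (fun=> `[- r, r]%classic)) => i; exact: segment_compact.
Qed.

Lemma cube_measurable r : measurable (cube r).
Proof. by case: (@lebesgue_rV_box R n (fun=> `[- r, r]%classic) (fun=> measurable_itv _)). Qed.

Lemma cubeP r x : cube r x <-> forall i, `|x ord0 i| <= r.
Proof. by split=> h i; have := h i; rewrite /= in_itv/= -ler_norml. Qed.

Lemma cube_le (r t : R) : r <= t -> cube r `<=` cube t.
Proof. by move=> rt x /cubeP xr; apply/cubeP => i; exact: le_trans (xr i) rt. Qed.

Lemma tensor_bounded phi : tensor_test phi ->
  exists M r, [/\ 0 <= M, forall x, `|tensor phi x| <= M &
                 forall x, ~ cube r x -> tensor phi x = 0].
Proof.
move=> tphi.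
have /choice[M MP] : forall i, exists M, forall x, `|phi i x| <= M.
  by move=> i; exact: test1_bounded.
have /choice[r rP] : forall i, exists r, forall x, r < `|x| -> phi i x = 0.
  by move=> i; case: (tphi i).
exists (\prod_i `|M i|), (\sum_i `|r i|); split.
- exact: prodr_ge0.
- move=> x; rewrite /tensor normr_prod; apply: ler_prod => i _.
  by rewrite normr_ge0/= (le_trans (MP i _))// ler_norm.
- move=> x /cubeP /existsNP[i] /negP; rewrite -ltNge => h.
  rewrite /tensor (bigD1 i)//= rP ?mul0r//; apply: le_lt_trans h.
  by rewrite (bigD1 i)//= (le_trans (ler_norm _))// lerDl sumr_ge0.
Qed.

End tensor.

(** * The fundamental lemma of the calculus of variations *)

Section locally_integrable.
Context {R : realType} {n : nat}.
Local Notation mu := (lebesgue_rV R n).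
Implicit Types (u v w g : 'rV[R]_n -> R).

(** Local integrability tested on cubes only: unlike integrability on every
    compact set, it can be checked without showing that compact sets are measurable. *)
Definition cube_integrable u := measurable_fun setT u /\
  forall r, mu.-integrable (cube r) (EFin \o u).

Lemma locally_integrable_cube u : locally_integrable_rV u -> cube_integrable u.
Proof. by move=> [mu_ iu]; split=> // r; apply: iu; exact: cube_compact. Qed.

Lemma integrable_mul_cube u g M r : cube_integrable u ->
  measurable_fun setT g -> (forall x, `|g x| <= M) ->
  (forall x, ~ cube r x -> g x = 0) ->
  mu.-integrable setT (EFin \o (fun x => u x * g x)).
Proof.
move=> lu mg gM g0; have [mu_ iu] := lu.
have M0 : 0 <= M by exact: le_trans (normr_ge0 _) (gM 0).
have : mu.-integrable setT ((EFin \o u) \_ (cube r)).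
  apply: (integrable_mkcond _ (@cube_measurable R n r)).1; exact: iu.
move=> /(integrableZl measurableT M); apply: le_integrable => //.
  by apply/measurable_EFinP; exact: measurable_funM.
move=> x _ /=; have [xr|xr] := pselect (cube r x).
  rewrite patchE mem_set//= lee_fin !normrM mulrC.
  by apply: ler_wpM2r => //; exact: le_trans (gM x) (ler_norm _).
by rewrite g0// mulr0 normr0 abse_ge0.
Qed.

Lemma integrable_mul_tensor u phi : cube_integrable u -> tensor_test phi ->
  mu.-integrable setT (EFin \o (fun x => u x * tensor phi x)).
Proof.
move=> lu tphi; have [M [r [_ phiM phi0]]] := tensor_bounded tphi.
by apply: integrable_mul_cube phi0 => //; exact: measurable_tensor.
Qed.

Definition box (a b : 'I_n -> R) : set 'rV[R]_n :=
  [set x | forall i, `]a i, b i[%classic (x ord0 i)].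

Lemma box_measurable a b : measurable (box a b).
Proof. by case: (@lebesgue_rV_box R n (fun i => `]a i, b i[%classic) (fun=> measurable_itv _)). Qed.

Lemma box_sub_cube a b : exists r, box a b `<=` cube r.
Proof.
exists (\sum_i (`|a i| + `|b i|)) => x xab; apply/cubeP => i.
rewrite (bigD1 i)//=.
have : 0 <= \sum_(j < n | j != i) (`|a j| + `|b j|) by apply: sumr_ge0 => j _; exact: addr_ge0.
have := xab i; rewrite /= in_itv/= => /andP[ax xb].
have := ler_norm (a i); have := ler_norm (b i); have := ler_norm (- a i); have := ler_norm (- b i).
rewrite !normrN => *; rewrite ler_norml; apply/andP; split; lra.
Qed.

Lemma indic_box a b x : \1_(box a b) x = \prod_(i < n) \1_(`]a i, b i[%classic) (x ord0 i) :> R.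
Proof.
rewrite indicE; have [xab|xab] := boolP (x \in box a b).
  rewrite big1// => i _; rewrite indicE mem_set//.
  by move: xab; rewrite inE; apply.
move: xab; rewrite notin_setE => /existsNP[i xi].
by rewrite (bigD1 i)//= indicE memNset// mul0r.
Qed.

(** Dominated convergence, along tensor products of the one-variable
    functions of [cutoff]. *)
Lemma integral_box_eq0 w : cube_integrable w ->
  (forall phi, tensor_test phi -> \int[mu]_x (w x * tensor phi x) = 0) ->
  forall a b, (\int[mu]_(x in box a b) (w x)%:E = 0)%E.
Proof.
move=> lw w0 a b; have [mw iw] := lw.
have /choice[phi phiP] : forall i, exists phi : nat -> R -> R,
  [/\ forall j, test1 (phi j),
    forall j x, 0 <= phi j x <= \1_(`]a i, b i[%classic) x &
    forall x, phi ^~ x @ \oo --> (\1_(`]a i, b i[%classic) x : R)].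
  by move=> i; exact: cutoff.
pose Phi j := fun i => phi i j.
have tPhi j : tensor_test (Phi j) by move=> i; have [+ _ _] := phiP i; apply.
have [r boxr] := box_sub_cube a b.
have PhiB j x : 0 <= tensor (Phi j) x <= \1_(box a b) x.
  rewrite indic_box /tensor; apply/andP; split.
    by apply: prodr_ge0 => i _; have [_ /(_ j (x ord0 i))/andP[]] := phiP i.
  by apply: ler_prod => i _; have [_ + _] := phiP i; apply.
have mI : measurable_fun setT (\1_(box a b) : 'rV[R]_n -> R).
  by apply: measurable_indic; exact: box_measurable.
have intw : mu.-integrable setT (EFin \o (fun x => w x * \1_(box a b) x)).
  apply: (@integrable_mul_cube w _ 1 r) => //.
    by move=> x; rewrite indicE; case: (_ \in _); rewrite ?normr1 ?normr0.
  by move=> x xr; rewrite indicE memNset// => /boxr.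
pose f_ j x := (w x * tensor (Phi j) x)%:E.
have -> : (\int[mu]_(x in box a b) (w x)%:E = \int[mu]_x (w x * \1_(box a b) x)%:E)%E.
  rewrite integral_mkcond; apply: eq_integral => x _.
  by rewrite patchE indicE; case: (_ \in _); rewrite ?mulr1 ?mulr0.
have cv : (\int[mu]_x f_ j x @[j --> \oo] --> \int[mu]_x (w x * \1_(box a b) x)%:E)%E.
  apply: (@dominated_cvg _ _ _ _ _ measurableT _ _ (fun x => `|w x * \1_(box a b) x|%:E)) => //.
  - by move=> j; apply/measurable_EFinP; apply: measurable_funM => //; exact: measurable_tensor.
  - move=> x _; apply: cvg_EFin; first exact: nearW.
    apply: cvgM; first exact: cvg_cst.
    rewrite indic_box /=.
    under eq_fun do rewrite /tensor.
    elim: (index_enum 'I_n) => [|i s IH].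
      rewrite big_nil (_ : (fun _ => _) = cst 1); first exact: cvg_cst.
      by apply/funext => j; rewrite big_nil.
    rewrite big_cons (_ : (fun _ => _) = fun j => Phi j i (x ord0 i) * \prod_(k <- s) Phi j k (x ord0 k)).
      by apply: cvgM => //; have [_ _] := phiP i; apply.
    by apply/funext => j; rewrite big_cons.
  - exact: integrable_abse intw.
  - move=> j x _; rewrite /f_ lee_fin !normrM ler_wpM2l//.
    have /andP[p0 p1] := PhiB j x.
    by rewrite !ger0_norm// (le_trans p0).
apply/esym; apply: (@cvg_unique _ _ _ _ _ _ _ cv) => //.
rewrite (_ : (fun j => _) = cst 0%E); first exact: cvg_cst.
apply/funext => j /=; have := w0 _ (tPhi j).
rewrite /Rintegral => /eqP; rewrite fine_eq0; first by move/eqP.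
exact: integrable_fin_num (integrable_mul_tensor lw (tPhi j)).
Qed.

(** Open boxes are stable under intersection; that they generate the
    sigma-algebra is what the pi-lambda argument of [fundamental_lemma] needs.
    A half space is the union of boxes growing in all other directions. *)
Lemma measurable_rVE : @measurable _ 'rV[R]_n = <<s [set box a.1 a.2 | a in [set: ('I_n -> R) * ('I_n -> R)]] >>.
Proof.
set G := [set _ | _ in _].
apply/seteqP; split; last first.
  apply: smallest_sub; first exact: sigma_algebra_measurable.
  by move=> _ [[a b] _ <-]; exact: box_measurable.
have mc (i : 'I_n) : measurable_fun [set: g_sigma_algebraType G]
    (fun x : g_sigma_algebraType G => (x : 'rV[R]_n) ord0 i).
  apply: (measurability _ (RGenOInfty.measurableE R)).
  move=> _ [_ [c ->] <-]; rewrite setTI.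
  rewrite (_ : _ @^-1` _ = \bigcup_m box (fun j => if j == i then c else - m%:R)
     (fun j => if j == i then c + m%:R else m%:R)).
    apply: bigcup_measurable => m _; apply: sub_sigma_algebra.
    by exists (fun j => if j == i then c else - m%:R, fun j => if j == i then c + m%:R else m%:R).
  apply/seteqP; split => x /=; last first.
    by move=> [m _ /(_ i)]; rewrite eqxx /= !in_itv/= => /andP[->].
  rewrite in_itv/= andbT => cx.
  (* Any integer above all coordinates and above |c| will do. *)
  exists (Num.trunc (\sum_j `|x ord0 j| + `|c|)).+1 => // j /=.
  set m := _.+1%:R.
  have Sm : \sum_j `|x ord0 j| + `|c| < m by exact: truncnS_gt.
  have xj : `|x ord0 j| + `|c| < m.
    apply: le_lt_trans Sm; rewrite lerD2r (bigD1 j)//= lerDl.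
    by apply: sumr_ge0.
  rewrite in_itv/=; have := ler_norm (x ord0 j); have := ler_norm (- x ord0 j).
  have := ler_norm c; have := ler_norm (- c); have := normr_ge0 c; rewrite !normrN => *.
  by case: eqP => [jE|_]; apply/andP; split; rewrite -?jE in cx *; try lra; subst j; lra.
apply: smallest_sub; first exact: smallest_sigma_algebra.
move=> A; rewrite -bigcup_seq/= => -[i _ [B mB <-]].
exact: mc.
Qed.

(** The integral of [w] vanishes on boxes, hence on all measurable subsets of
    a fixed bounded box by the pi-lambda theorem, hence [w] is null there. *)
Lemma fundamental_lemma w : cube_integrable w ->
  (forall phi, tensor_test phi -> \int[mu]_x (w x * tensor phi x) = 0) ->
  {ae mu, forall x, w x = 0}.
Proof.
move=> lw w0; have [mw iw] := lw.
have box0 := integral_box_eq0 lw w0.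
pose K (m : nat) := box (fun=> - m%:R) (fun=> m%:R).
have mK m : measurable (K m) by exact: box_measurable.
have intK m : mu.-integrable (K m) (EFin \o w).
  have [r Kr] := box_sub_cube (fun=> - m%:R) (fun=> m%:R).
  have mcr := @cube_measurable R n r.
  exact: (integrableS mcr (mK m) Kr (iw r)).
have intE m E : measurable E -> mu.-integrable (E `&` K m) (EFin \o w).
  by move=> mE; apply: (integrableS (mK m) (measurableI _ _ mE (mK m)) _ (intK m)).
have all0 m E : measurable E -> (\int[mu]_(x in E `&` K m) (w x)%:E = 0)%E.
  move=> mE; have : <<s [set box a.1 a.2 | a in [set: ('I_n -> R) * ('I_n -> R)]] >> E.
    by rewrite -measurable_rVE.
  apply: (@dynkin_induction _ _ _ (fun E => \int[mu]_(x in E `&` K m) (w x)%:E = 0)%E).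
  - exact: measurable_rVE.
  - move=> _ _ [[a b] _ <-] [[a' b'] _ <-].
    exists (fun i => Num.max (a i) (a' i), fun i => Num.min (b i) (b' i)) => //.
    apply/seteqP; split=> x /=.
      by move=> h; split => i; have := h i; rewrite /= !in_itv/= gt_max lt_min => /andP[/andP[? ?] /andP[? ?]]; apply/andP.
    move=> [h1 h2] i; have := h1 i; have := h2 i.
    by rewrite /= !in_itv/= gt_max lt_min => /andP[-> ->] /andP[-> ->].
  - by rewrite setTI; exact: box0.
  - move=> _ [[a b] _ <-].
    rewrite (_ : box a b `&` K m = box (fun i => Num.max (a i) (- m%:R)) (fun i => Num.min (b i) m%:R)).
      exact: box0.
    apply/seteqP; split=> x /=.
      move=> [h1 h2] i; have := h1 i; have := h2 i.
      by rewrite /= !in_itv/= gt_max lt_min => /andP[-> ->] /andP[-> ->].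
    by move=> h; split => i; have := h i; rewrite /= !in_itv/= gt_max lt_min => /andP[/andP[? ?] /andP[? ?]]; apply/andP.
  - move=> S mS S0.
    have KE : K m = (S `&` K m) `|` (~` S `&` K m) by rewrite -setIUl setUv setTI.
    have := box0 (fun=> - m%:R) (fun=> m%:R); rewrite -/(K m) [X in integral _ X]KE.
    have mS' := measurableC mS.
    rewrite integral_setU ?S0 ?add0r ?add0e//.
    + exact: measurableI.
    + exact: measurableI.
    + by rewrite -KE; case/integrableP: (intK m).
    + by apply/disj_set2P; rewrite setIACA setICr set0I.
  - move=> F mF tF F0; rewrite setI_bigcupl integral_bigcup//.
    + by rewrite (eq_eseriesr (fun i _ => F0 i)) eseries0.
    + exact: trivIset_setIr.
    + by move=> k; exact: measurableI.
    + by rewrite -setI_bigcupl; apply: intE; exact: bigcup_measurable.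
have aeK m : {ae mu, forall x, K m x -> w x = 0}.
  have h : ae_eq mu (K m) (EFin \o w) (cst 0%E).
    apply: (integral_ae_eq (mK m) (intK m)); first exact: measurable_cst.
    move=> E EK mE; rewrite integral0 -(setIidl EK); exact: all0.
  by apply: filterS h => x /= h /h [].
have : {ae mu, forall x m, K m x -> w x = 0} by apply/ae_foralln.
apply: filterS => x h.
pose m := (Num.trunc (\sum_j `|x ord0 j|)).+1.
apply: (h m) => i; rewrite /= in_itv/= -ltr_norml.
apply: le_lt_trans (truncnS_gt _); rewrite (bigD1 i)//= lerDl.
by apply: sumr_ge0.
Qed.

End locally_integrable.

(** * Averages over segments *)

Section unit_interval.
Context {R : realType}.

(** Averages over a segment are integrals against this probability, which
    makes the theorems on product measures apply without restricting domains. The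
    density matters for [integral_unit_prob] only. *)
Definition unit_prob : probability (measurableTypeR R) R :=
  locked (uniform_prob (@ltr01 R) : probability _ _).

Local Open Scope ereal_scope.

Lemma integral_unit_prob (f : measurableTypeR R -> \bar R) : measurable_fun setT f ->
  \int[unit_prob]_t f t = \int[lebesgue_measure]_(t in `[0%R, 1%R]) f t.
Proof.
move=> mf.
have ge0 (g : measurableTypeR R -> \bar R) : measurable_fun setT g -> (forall x, 0 <= g x) ->
    \int[unit_prob]_t g t = \int[lebesgue_measure]_(t in `[0%R, 1%R]) g t.
  move=> mg g0; rewrite /unit_prob -lock.
  by rewrite integral_uniform// subr0 invr1 mul1e.
rewrite [LHS]integralE [RHS]integralE; congr (_ - _); apply: ge0 => //.
exact: measurable_funepos.
exact: measurable_funeneg.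
Qed.

Lemma ae_unit_prob : {ae unit_prob, forall t, (0 <= t <= 1)%R}.
Proof.
exists (~` `[0%R, 1%R]%classic); split.
- exact: measurableC.
- have := integral_unit_prob (f := fun t => (\1_(~` `[0%R, 1%R]%classic) t)%:E).
  rewrite integral_indic ?setIT; [|exact: measurableT|exact: measurableC].
  move=> ->; last by apply/measurable_EFinP; apply: measurable_indic; exact: measurableC.
  rewrite integral_indic; [|exact: measurable_itv|exact: measurableC].
  by rewrite setICl measure0.
- by move=> t /=; rewrite in_itv.
Qed.

Lemma integral_unit_prob_derive (F f : R -> R) :
  (forall t, is_derive t (1:R)%R F (f t)) -> continuous f ->
  \int[unit_prob]_t (f t)%:E = (F 1%R - F 0%R)%:E.
Proof.
move=> dF cf; rewrite integral_unit_prob; last first.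
  by apply/measurable_EFinP; exact: continuous_measurable_fun.
have cF : continuous F.
  move=> t; apply: differentiable_continuous; apply/derivable1_diffP.
  by case: (dF t).
rewrite (@continuous_FTC2 _ f F) ?EFinB//.
- exact: continuous_subspaceT.
- split; [by move=> t _; case: (dF t)|apply: cvg_at_right_filter|apply: cvg_at_left_filter];
    exact: cF.
- by move=> t _; rewrite derive1E (@derive_val _ _ _ _ _ _ _ (dF t)).
Qed.

End unit_interval.

Section segment.
Context {R : realType} {n : nat}.
Implicit Types (phi : 'I_n -> R -> R) (x z : 'rV[R]_n).

(** The derivative of a tensor product in the direction [z]. *)
Definition dir_tensor z phi x : R :=
  \sum_(i < n) z ord0 i * tensor (tensor_derive (munit i) phi) x.

(** Leibniz rule for a finite product of functions of [t], by induction on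
    the list of factors. In the sum the [i]-th product is the one where the [i]-th
    factor has been differentiated, which is what [tensor_derive (munit i)] encodes. *)
Lemma is_derive_tensor_segment phi x z (t : R) : tensor_test phi ->
  is_derive t (1:R) (fun t => tensor phi (x - t *: z)) (- dir_tensor z phi (x - t *: z)).
Proof.
move=> tphi.
have di i : is_derive t (1:R) (fun t => phi i ((x - t *: z) ord0 i))
    (- (z ord0 i * derive1 (phi i) ((x - t *: z) ord0 i))).
  rewrite (_ : (fun t => _) = phi i \o (fun t => x ord0 i - t * z ord0 i)); last first.
    by apply/funext => s; rewrite /= !mxE.
  rewrite !mxE -mulNr mulrC; apply: is_derive1_comp.
    by rewrite derive1E; apply: derivableP; apply: smooth1_derivable; case: (tphi i).
  have := is_deriveB (is_derive_cst (x ord0 i) t (1:R)) (is_deriveZ (z ord0 i) (is_derive_id t (1:R))).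
  rewrite sub0r [_ *: _]mulr1 [X in is_derive _ _ X _ -> _](_ : _ = (fun t => x ord0 i - t * z ord0 i))//.
  by apply/funext => s; rewrite !fctE /GRing.scale/= mulrC.
suff H (r : seq 'I_n) : uniq r ->
   is_derive t (1:R) (fun t => \prod_(i <- r) phi i ((x - t *: z) ord0 i))
     (- \sum_(i <- r) z ord0 i * \prod_(j <- r) tensor_derive (munit i) phi j ((x - t *: z) ord0 j)).
  rewrite /dir_tensor /tensor; exact: H (index_enum_uniq _).
elim: r => [_|i r IH /= /andP[ir ur]].
  rewrite big_nil oppr0 (_ : (fun t => _) = cst 1); first exact: is_derive_cst.
  by apply/funext => s; rewrite big_nil.
rewrite (_ : (fun t => _) = (fun t => phi i ((x - t *: z) ord0 i)) * (fun t =>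
    \prod_(i <- r) phi i ((x - t *: z) ord0 i))); last first.
  by apply/funext => s; rewrite big_cons.
apply: is_derive_eq (is_deriveM (di i) (IH ur)) _.
rewrite big_cons opprD addrC; congr (_ + _).
  rewrite /GRing.scale/= mulrN mulrCA; congr (- (_ * _)).
  rewrite big_cons {1}/tensor_derive /munit eqxx derive1n1 mulrC; congr (_ * _).
  rewrite big_seq [RHS]big_seq; apply: eq_bigr => j jr.
  by rewrite /tensor_derive (_ : (j == i) = false)//; apply/negbTE; apply: contraNneq ir => <-.
rewrite /GRing.scale/= mulrN mulr_sumr; congr (- _).
rewrite big_seq [RHS]big_seq; apply: eq_bigr => j jr.
rewrite mulrCA big_cons; congr (_ * (_ * _)).
by rewrite /tensor_derive /munit (_ : (i == j) = false)//; apply/negbTE; apply: contraNneq ir => ->.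
Qed.

Lemma continuous_dir_tensor_segment phi x z : tensor_test phi ->
  continuous (fun t : R => dir_tensor z phi (x - t *: z)).
Proof.
move=> tphi; rewrite /dir_tensor; elim: (index_enum 'I_n) => [|i r IH] t.
  rewrite (_ : (fun t => _) = cst 0); first exact: cvg_cst.
  by apply/funext => s; rewrite big_nil.
rewrite (_ : (fun t => _) = (fun s : R => z ord0 i * tensor (tensor_derive (munit i) phi) (x - s *: z) +
    \sum_(j <- r) z ord0 j * tensor (tensor_derive (munit j) phi) (x - s *: z))); last first.
  by apply/funext => s; rewrite big_cons.
apply: cvgD; last exact: IH.
apply: cvgM; first exact: cvg_cst.
apply: (@differentiable_continuous _ _ _ _ (fun s : R => tensor (tensor_derive (munit i) phi) (x - s *: z))).
apply/derivable1_diffP.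
by case: (@is_derive_tensor_segment (tensor_derive (munit i) phi) x z t (tensor_test_derive _ tphi)).
Qed.

Lemma integral_dir_tensor phi x z : tensor_test phi ->
  (\int[unit_prob]_t (dir_tensor z phi (x - t *: z))%:E = (tensor phi x - tensor phi (x - z))%:E)%E.
Proof.
move=> tphi.
have dF t : is_derive t (1:R) (fun t => - tensor phi (x - t *: z)) (dir_tensor z phi (x - t *: z)).
  have := is_deriveN (is_derive_tensor_segment x z t tphi).
  by rewrite opprK.
rewrite (integral_unit_prob_derive dF); last exact: continuous_dir_tensor_segment.
by rewrite scale1r scale0r subr0 opprK addrC.
Qed.

Lemma test1_shift (f : R -> R) (c : R) : test1 f -> test1 (fun t => f (t + c)).
Proof.
move=> [sf [r rf]]; split.
  move=> m; rewrite (_ : (fun t => _) = (fun t => f (1 * t + c))).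
    exact: ndiff_affine.
  by apply/funext => t; rewrite mul1r.
exists (r + `|c|) => t h; apply: rf.
have := ler_normD (t + c) (- c); rewrite addrK normrN => ?; lra.
Qed.

Definition tensor_translate (h : 'rV[R]_n) phi := fun i t => phi i (t + h ord0 i).

Lemma tensor_test_shift h phi : tensor_test phi -> tensor_test (tensor_translate h phi).
Proof. by move=> tphi i; exact: test1_shift. Qed.

Lemma tensor_shift h phi x : tensor (tensor_translate h phi) x = tensor phi (x + h).
Proof. by apply: eq_bigr => i _; rewrite /tensor_translate mxE. Qed.

Lemma dir_tensor_shift h z phi x : dir_tensor z (tensor_translate h phi) x = dir_tensor z phi (x + h).
Proof.
apply: eq_bigr => i _; congr (_ * _).
apply: eq_bigr => j _; rewrite /tensor_derive /munit mxE.
case: (j == i) => //=; rewrite !derive1E /derive/= /tensor_translate.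
by under eq_fun do rewrite -addrA.
Qed.

End segment.

Section cube_integrable_theory.
Context {R : realType} {n : nat}.
Local Notation mu := (lebesgue_rV R n).
Implicit Types (u v w S psi : 'rV[R]_n -> R) (x z : 'rV[R]_n).

Lemma cube_integrableD u v : cube_integrable u -> cube_integrable v ->
  cube_integrable (fun x => u x + v x).
Proof.
move=> [mu_ iu] [mv iv]; split=> [|r]; first exact: measurable_funD.
apply: eq_integrable (integrableD (@cube_measurable R n r) (iu r) (iv r)) => //.
exact: cube_measurable.
Qed.

Lemma cube_integrableZ (c : R) u : cube_integrable u ->
  cube_integrable (fun x => c * u x).
Proof.
move=> [mu_ iu]; split=> [|r]; first exact: measurable_funM.
apply: eq_integrable (integrableZl (@cube_measurable R n r) c (iu r)) => //.
exact: cube_measurable.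
Qed.

Lemma cube_integrable_sum (I : Type) (s : seq I) (F : I -> 'rV[R]_n -> R) :
  (forall i, cube_integrable (F i)) -> cube_integrable (fun x => \sum_(i <- s) F i x).
Proof.
move=> iF; elim: s => [|i s IH].
  rewrite (_ : (fun x => _) = (fun x => 0 * 0)).
    by apply: cube_integrableZ; split=> [|r]; [exact: measurable_cst|exact: integrable0].
  by apply/funext => x; rewrite big_nil mul0r.
rewrite (_ : (fun x => _) = (fun x => F i x + \sum_(i <- s) F i x)).
  exact: cube_integrableD.
by apply/funext => x; rewrite big_cons.
Qed.

Lemma cube_shift r h x : cube r (x - h) -> cube (r + \sum_i `|h ord0 i|) x.
Proof.
move=> /cubeP xh; apply/cubeP => i; have := xh i; rewrite !mxE.
have : `|h ord0 i| <= \sum_i `|h ord0 i| by rewrite (bigD1 i)//= lerDl sumr_ge0.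
have := ler_normD (x ord0 i - h ord0 i) (h ord0 i); rewrite subrK; lra.
Qed.

Lemma cube_integrable_shift h u : cube_integrable u ->
  cube_integrable (fun x => u (x + h)).
Proof.
move=> [mu_ iu]; split=> [|r]; first exact: measurableT_comp mu_ (measurable_rV_shift h).
have mcr := @cube_measurable R n r.
pose t := r + \sum_i `|h ord0 i|.
apply/(integrable_mkcond _ mcr).
have := integrable_translation h ((integrable_mkcond _ (@cube_measurable R n t)).1 (iu t)).
apply: le_integrable => //.
  apply: (measurable_restrictT _ mcr).1.
  apply: measurable_funTS; apply/measurable_EFinP.
  exact: measurableT_comp mu_ (measurable_rV_shift h).
move=> x _; rewrite !patchE; case: ifPn => [/set_mem xr|_].
  by rewrite mem_set//; apply: cube_shift; rewrite addrK.
by rewrite abse0 abse_ge0.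
Qed.

End cube_integrable_theory.

Section weak_FTC.
Context {R : realType} {n : nat}.
Local Notation mu := (lebesgue_rV R n).
Implicit Types (u v w S psi : 'rV[R]_n -> R) (x z : 'rV[R]_n).

Lemma measurable_segment z : measurable_fun [set: 'rV[R]_n * measurableTypeR R]
  (fun q => q.1 + (q.2 : R) *: z).
Proof.
apply/measurable_fun_rVP => i; under eq_fun do rewrite !mxE.
apply: measurable_funD.
  exact: measurableT_comp (measurable_coord i) measurable_fst.
by apply: measurable_funM => //; exact: measurable_snd.
Qed.

Section shifts.
Variables (S psi : 'rV[R]_n -> R) (M r : R) (z : 'rV[R]_n).
Hypotheses (iS : cube_integrable S) (mpsi : measurable_fun setT psi).
Hypotheses (psiM : forall x, `|psi x| <= M) (psi0 : forall x, ~ cube r x -> psi x = 0).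
Local Open Scope ereal_scope.

(* Translates of psi by t z with t in [0, 1] all live in one larger cube. *)
Let bound : exists C : R, forall t : R, (0 <= t <= 1)%R ->
  \int[mu]_x `|(S x * psi (x - t *: z)%R)%:E| <= C%:E.
Proof.
have [mS iS'] := iS.
pose r' := (r + \sum_i `|z ord0 i|)%R.
have M0 : (0 <= M)%R by exact: le_trans (normr_ge0 _) (psiM 0%R).
have i1 : mu.-integrable setT (fun x => M%:E * ((EFin \o S) \_ (cube r')) x).
  apply: integrableZl => //.
  exact/(integrable_mkcond _ (@cube_measurable R n r'))/iS'.
exists (fine (\int[mu]_x `|M%:E * ((EFin \o S) \_ (cube r')) x|)) => t /andP[t0 t1].
rewrite fineK; last by apply: integrable_fin_num => //; exact: integrable_abse i1.
apply: ge0_le_integral => //.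
- apply: measurableT_comp => //; apply/measurable_EFinP; apply: measurable_funM => //.
  exact: measurableT_comp mpsi (measurable_rV_shift _).
- by apply: measurableT_comp => //; case/integrableP : i1.
move=> x _; have [xr|xr] := pselect (cube r' x).
  rewrite patchE mem_set//= lee_fin !normrM mulrC.
  by apply: ler_wpM2r => //; exact: le_trans (psiM _) (ler_norm _).
rewrite psi0 ?mulr0 ?abse0 ?abse_ge0// => /cube_shift xr'; apply: xr.
apply: cube_le xr'; rewrite lerD2l; apply: ler_sum => i _.
by rewrite mxE normrM (ger0_norm t0) ler_piMl.
Qed.

Let int_le (F : 'rV[R]_n * measurableTypeR R -> R) : measurable_fun setT F ->
  (forall t : R, (\int[mu]_x `|(F (x, t))%:E| = \int[mu]_x `|(S x * psi (x - t *: z)%R)%:E|)) ->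
  (mu \x unit_prob).-integrable setT (EFin \o F).
Proof.
move=> mF FE; have [C CP] := bound.
have mF' : measurable_fun setT (EFin \o F) by exact/measurable_EFinP.
apply/(integrable21ltyP mu unit_prob mF').
apply: (@le_lt_trans _ _ (\int[unit_prob]_t `|C%:E|)).
  apply: ae_ge0_le_integral => //.
  - by move=> t _; exact: integral_ge0.
  - apply: (measurable_fun_fubini_tonelli_G (fun q => `|(F q)%:E|)) => //.
    exact: measurableT_comp.
  have := @ae_unit_prob R; apply: (@filterS _ _ (ae_filter_ringOfSetsType _)) => t t01 _ /=; rewrite FE; apply: le_trans (CP _ t01) _.
  by rewrite lee_fin ler_norm.
rewrite integral_cst// [X in _ * X](@probability_setT _ _ _ (@unit_prob R)) mule1.
by rewrite ltry.
Qed.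

(** Together with [integrable_segment_r] this licenses Fubini's theorem
    before and after the change of variables [x -> x - t z]. *)
Lemma integrable_segment_l :
  (mu \x unit_prob).-integrable setT (fun q => (S (q.1 + q.2 *: z)%R * psi q.1)%:E).
Proof.
have [mS _] := iS.
apply: (int_le (F := fun q => (S (q.1 + q.2 *: z) * psi q.1)%R)).
  apply: measurable_funM; last exact: measurableT_comp mpsi measurable_fst.
  exact: measurableT_comp mS (measurable_segment z).
move=> t; rewrite -[RHS](ge0_integral_translation (t *: z)%R
  (f := fun x => `|(S x * psi (x - t *: z)%R)%:E|))//.
  by apply: eq_integral => x _; rewrite /= addrK.
apply: measurableT_comp => //; apply/measurable_EFinP; apply: measurable_funM => //.
exact: measurableT_comp mpsi (measurable_rV_shift _).
Qed.

Lemma integrable_segment_r :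
  (mu \x unit_prob).-integrable setT (fun q => (S q.1 * psi (q.1 - q.2 *: z)%R)%:E).
Proof.
have [mS _] := iS.
apply: (int_le (F := fun q => (S q.1 * psi (q.1 - q.2 *: z))%R)) => //.
apply: measurable_funM; first exact: measurableT_comp mS measurable_fst.
have := measurableT_comp mpsi (measurable_segment (- z)%R).
by under eq_fun do rewrite scalerN.
Qed.

End shifts.
End weak_FTC.

(** * The fundamental theorem of calculus for weak derivatives *)

Section weak_FTC2.
Context {R : realType} {n : nat}.
Local Notation mu := (lebesgue_rV R n).
Implicit Types (u v w S psi : 'rV[R]_n -> R) (x z : 'rV[R]_n).

Lemma dir_tensor_bounded z phi : tensor_test phi ->
  exists M r, (forall x, `|dir_tensor z phi x| <= M) /\
     (forall x, ~ cube r x -> dir_tensor z phi x = 0).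
Proof.
move=> tphi.
have /choice[Mr MrP] : forall i, exists Mr : R * R, (forall x, `|tensor (tensor_derive (munit i) phi) x| <= Mr.1) /\
     (forall x, ~ cube Mr.2 x -> tensor (tensor_derive (munit i) phi) x = 0).
  move=> i; have [M [r [_ h1 h2]]] := tensor_bounded (tensor_test_derive (munit i) tphi).
  by exists (M, r).
exists (\sum_i `|z ord0 i| * (Mr i).1), (\sum_i `|(Mr i).2|); split => x.
  rewrite /dir_tensor (le_trans (ler_norm_sum _ _ _))//; apply: ler_sum => i _.
  by rewrite normrM ler_wpM2l//; have [+ _] := MrP i; apply.
move=> xr; rewrite /dir_tensor big1// => i _; have [_ ->] := MrP i; first by rewrite mulr0.
apply: contra_not xr; apply: cube_le.
by rewrite (bigD1 i)//= (le_trans (ler_norm _))// lerDl sumr_ge0.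
Qed.

Lemma measurable_dir_tensor z phi : tensor_test phi -> measurable_fun setT (dir_tensor z phi).
Proof.
move=> tphi; apply: measurable_sum => i; apply: measurable_funM => //.
by apply: measurable_tensor; exact: tensor_test_derive.
Qed.

Definition dir_weak_derivative z v S := forall phi, tensor_test phi ->
  \int[mu]_x (v x * dir_tensor z phi x) = - \int[mu]_x (S x * tensor phi x).

Variables (z : 'rV[R]_n) (S : 'rV[R]_n -> R).
Hypothesis iS : cube_integrable S.

Definition segment_mean x : R := \int[unit_prob]_t S (x + t *: z).

Lemma ae_segment_integrable :
  {ae mu, forall x, unit_prob.-integrable setT (fun t => (S (x + t *: z))%:E)}.
Proof.
have H m : {ae mu, forall x, cube m%:R x -> unit_prob.-integrable setT (fun t => (S (x + t *: z))%:E)}.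
  pose psi : 'rV[R]_n -> R := \1_(cube m%:R).
  have mpsi : measurable_fun setT psi by apply: measurable_indic; exact: cube_measurable.
  have := @integrable_segment_l R n S psi 1 m%:R z iS mpsi.
  move=> /(_ _ _)/ae_integrable1.
  have psi1 x : `|psi x| <= 1 by rewrite /psi indicE; case: (_ \in _); rewrite ?normr1 ?normr0.
  have psi0 x : ~ cube m%:R x -> psi x = 0 by move=> ?; rewrite /psi indicE memNset.
  move=> /(_ psi1 psi0); apply: filterS => x h xm.
  apply: eq_integrable h => // t _ /=.
  by rewrite /psi indicE mem_set// mulr1.
have : {ae mu, forall x m, cube m%:R x -> unit_prob.-integrable setT (fun t => (S (x + t *: z))%:E)}.
  by apply/ae_foralln.
apply: filterS => x /(_ (Num.trunc (\sum_i `|x ord0 i|)).+1); apply.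
apply/cubeP => i; apply/ltW; apply: le_lt_trans (truncnS_gt _).
by rewrite (bigD1 i)//= lerDl sumr_ge0.
Qed.

(** Measurability holds for the integrals of the positive and negative parts,
    hence for their difference, even at points where neither is finite. *)
Lemma measurable_segment_mean : measurable_fun setT segment_mean.
Proof.
have [mS _] := iS.
pose F := fun q : 'rV[R]_n * measurableTypeR R => (S (q.1 + (q.2 : R) *: z))%:E.
have mF : measurable_fun setT F.
  by apply/measurable_EFinP; exact: measurableT_comp mS (measurable_segment z).
have -> : segment_mean = fun x => fine (\int[unit_prob]_t F^\+ (x, t) - \int[unit_prob]_t F^\- (x, t))%E.
  apply/funext => x; rewrite /segment_mean /Rintegral integralE.
  by rewrite (funepos_comp F (fun t => (x, t))) (funeneg_comp F (fun t => (x, t))).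
apply: (measurableT_comp (@fine_measurable R setT measurableT)).
apply: emeasurable_funB; apply: measurable_fun_fubini_tonelli_F => //.
exact: measurable_funepos.
exact: measurable_funeneg.
Qed.

Lemma cube_integrable_segment_mean : cube_integrable segment_mean.
Proof.
split=> [|r]; first exact: measurable_segment_mean.
pose psi : 'rV[R]_n -> R := \1_(cube r).
have mcr := @cube_measurable R n r.
have mpsi : measurable_fun setT psi by exact: measurable_indic.
have psi1 x : `|psi x| <= 1 by rewrite /psi indicE; case: (_ \in _); rewrite ?normr1 ?normr0.
have psi0 x : ~ cube r x -> psi x = 0 by move=> ?; rewrite /psi indicE memNset.
have := integrable_fubini_F (integrable_segment_l z iS mpsi psi1 psi0).
move=> h; apply/(integrable_mkcond _ mcr); apply: le_integrable h => //.
  apply: (measurable_restrictT _ mcr).1.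
  by apply: measurable_funTS; apply/measurable_EFinP; exact: measurable_segment_mean.
move=> x _; rewrite patchE; case: ifPn => [/set_mem xr|_]; last by rewrite abse0 abse_ge0.
rewrite /fubini_F /= /psi indicE mem_set//.
under [X in (_ <= `|X|)%E]eq_integral do rewrite mulr1.
(* At points where the integral is infinite, [fine] returns 0. *)
rewrite /segment_mean /Rintegral; case: (\int[_]_ _ _)%E => [a| |] //=.
by rewrite normr0 leey.
by rewrite normr0 leey.
Qed.


Local Open Scope ereal_scope.

Lemma integral_dir_weak_segment v phi (t : R) : dir_weak_derivative z v S -> tensor_test phi ->
  cube_integrable v ->
  \int[mu]_x (S (x + t *: z)%R * tensor phi x)%:E =
  - \int[mu]_x (v x * dir_tensor z phi (x - t *: z)%R)%:E.
Proof.
move=> dw tphi iv; have tshi := tensor_test_shift (- (t *: z))%R tphi.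
have [mS _] := iS; have [mv _] := iv.
have [M [r [DM D0]]] := dir_tensor_bounded z tshi.
have i1 := integrable_mul_tensor iS tshi.
have i2 := integrable_mul_cube iv (measurable_dir_tensor z tshi) DM D0.
have : \int[mu]_x (v x * dir_tensor z (tensor_translate (- (t *: z)) phi) x)%:E =
    - \int[mu]_x (S x * tensor (tensor_translate (- (t *: z)) phi) x)%:E.
  rewrite -[LHS]fineK; last exact: integrable_fin_num i2.
  rewrite -[X in - X]fineK; last exact: integrable_fin_num i1.
  by rewrite -EFinN; congr EFin; exact: dw.
under [X in X = _ -> _]eq_integral do rewrite dir_tensor_shift.
move=> ->; rewrite oppeK.
under [RHS]eq_integral do rewrite tensor_shift.
rewrite -[RHS](integral_translation (t *: z)%R (f := fun x => (S x * tensor phi (x - t *: z)%R)%:E)).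
  by apply: eq_integral => x _; rewrite addrK.
apply/measurable_EFinP; apply: measurable_funM => //.
exact: measurableT_comp (measurable_tensor tphi) (measurable_rV_shift _).
Qed.

(** Fubini moves the average over the segment outside, translation moves the
    shift from [S] to the test function, the weak derivative turns [S] into [v],
    and the average of the derivative of the test function over the segment is a
    difference of two values. *)
Lemma integral_segment_mean v phi : dir_weak_derivative z v S -> tensor_test phi ->
  cube_integrable v ->
  \int[mu]_x (segment_mean x * tensor phi x)%:E =
  \int[mu]_x (v x * (tensor phi (x - z)%R - tensor phi x))%:E.
Proof.
move=> dw tphi iv; have [mS _] := iS; have [mv _] := iv.
have [M [r [_ phiM phi0]]] := tensor_bounded tphi.
have [M' [r' [DM D0]]] := dir_tensor_bounded z tphi.
have mphi := measurable_tensor tphi.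
have i1 := integrable_segment_l z iS mphi phiM phi0.
have i2 := integrable_segment_r z iv (measurable_dir_tensor z tphi) DM D0.
transitivity (\int[mu]_x \int[unit_prob]_t (S (x + t *: z)%R * tensor phi x)%:E).
  apply: ae_eq_integral => //.
  - apply/measurable_EFinP; apply: measurable_funM => //.
    exact: measurable_segment_mean.
  - exact: (measurable_fubini_F i1).
  have := ae_segment_integrable; apply: filterS => x ix _.
  under [RHS]eq_integral do rewrite EFinM muleC.
  rewrite integralZl// muleC EFinM /segment_mean /Rintegral fineK//.
  exact: integrable_fin_num ix.
rewrite (Fubini i1) /=.
under eq_integral => t _ do rewrite (integral_dir_weak_segment t dw tphi iv).
transitivity (\int[unit_prob]_t \int[mu]_x - (v x * dir_tensor z phi (x - t *: z)%R)%:E).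
  apply: eq_integral => t _; rewrite -integralN//.
  apply: integrable_add_def => //.
  have tshi := tensor_test_shift (- (t *: z))%R tphi.
  have [N [q [DN Dq]]] := dir_tensor_bounded z tshi.
  have := integrable_mul_cube iv (measurable_dir_tensor z tshi) DN Dq.
  by under eq_fun do rewrite dir_tensor_shift.
have i2' := integrableN i2.
transitivity (\int[mu]_x \int[unit_prob]_t - (v x * dir_tensor z phi (x - t *: z)%R)%:E).
  exact/esym/(Fubini i2').
apply: eq_integral => x _ /=.
transitivity (\int[unit_prob]_t ((- v x)%:E * (dir_tensor z phi (x - t *: z)%R)%:E)).
  by apply: eq_integral => t _; rewrite -EFinM mulNr EFinN.
rewrite integralZl//.
  by rewrite integral_dir_tensor// -EFinM; congr EFin; ring.
apply: (@le_integrable _ _ _ _ _ measurableT _ (cst M'%:E)).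
- apply/measurable_EFinP; apply: continuous_measurable_fun.
  exact: continuous_dir_tensor_segment.
- by move=> t _ /=; rewrite lee_fin (le_trans (DM _))// ler_norm.
- exact: finite_measure_integrable_cst.
Qed.

(** Fundamental theorem of calculus on almost every segment parallel to
    [z]. Both sides have the same integral against every tensor product, by
    [integral_segment_mean] and a translation. *)
Theorem weak_FTC v : dir_weak_derivative z v S -> cube_integrable v ->
  {ae mu, forall x, (v (x + z) - v x)%R = segment_mean x}.
Proof.
move=> dw iv.
pose H x := (v (x + z) + (-1 * v x + -1 * segment_mean x))%R.
have iH : cube_integrable H.
  apply: cube_integrableD; first exact: cube_integrable_shift.
  by apply: cube_integrableD; apply: cube_integrableZ => //; exact: cube_integrable_segment_mean.
suff : {ae mu, forall x, H x = 0%R}.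
  by apply: filterS => x; rewrite /H; lra.
apply: (fundamental_lemma iH) => phi tphi.
have ivz := cube_integrable_shift z iv.
have im := cube_integrable_segment_mean.
have j1 := integrable_mul_tensor ivz tphi.
have j2 := integrable_mul_tensor iv tphi.
have j3 := integrable_mul_tensor im tphi.
have tsh := tensor_test_shift (- z)%R tphi.
have j4 := integrable_mul_tensor iv tsh.
have E1 : \int[mu]_x (v (x + z)%R * tensor phi x)%:E = \int[mu]_x (v x * tensor phi (x - z)%R)%:E.
  rewrite -[RHS](integral_translation z (f := fun x => (v x * tensor phi (x - z)%R)%:E)).
    by apply: eq_integral => x _; rewrite addrK.
  apply/measurable_EFinP; apply: measurable_funM; first by case: iv.
  exact: measurableT_comp (measurable_tensor tphi) (measurable_rV_shift _).
have E2 := integral_segment_mean dw tphi iv.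
have j4' : mu.-integrable setT (EFin \o (fun x => v x * tensor phi (x - z))%R).
  by apply: eq_integrable j4 => // x _ /=; rewrite tensor_shift.
transitivity ((\int[mu]_x (v (x + z) * tensor phi x) - \int[mu]_x (v x * tensor phi x)) -
   \int[mu]_x (segment_mean x * tensor phi x))%R.
  rewrite -!RintegralB//.
    by apply: eq_Rintegral => x _; rewrite /H; ring.
  exact: (integrableB measurableT j1 j2).
apply/eqP; rewrite subr_eq0; apply/eqP; rewrite /Rintegral E1 E2.
rewrite -!/(Rintegral _ _ _) -RintegralB//.
by apply: eq_Rintegral => x _; ring.
Qed.

End weak_FTC2.

(** * Multi-indices and Taylor polynomials *)

Section multi_index_combinatorics.
Context {R : realType} {n : nat}.
Implicit Types (a b : 'I_n -> nat) (z : 'rV[R]_n).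

(** The multi-index [a + e_i]. *)
Definition mincr i a : 'I_n -> nat := fun j => (a j + (j == i))%N.

Lemma mdeg_munit (i : 'I_n) : mdeg (munit i) = 1%N.
Proof.
rewrite /mdeg (bigD1 i)//= /munit eqxx big1// => j ji.
by rewrite (negbTE ji).
Qed.

Lemma mdeg_mincr i a : mdeg (mincr i a) = (mdeg a).+1.
Proof. by rewrite /mdeg /mincr big_split/= -[X in (_ + X)%N]/(mdeg (munit i)) mdeg_munit addn1. Qed.

Lemma mfact_mincr i a : mfact (mincr i a) = ((a i).+1 * mfact a)%N.
Proof.
rewrite /mfact /mincr (bigD1 i)//= [in RHS](bigD1 i)//= eqxx addn1 factS mulnA.
by congr (_ * _)%N; apply: eq_bigr => j ji; rewrite (negbTE ji) addn0.
Qed.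

Lemma mpow_mincr z i a : mpow z (mincr i a) = z ord0 i * mpow z a.
Proof.
rewrite /mpow /mincr (bigD1 i)//= [in RHS](bigD1 i)//= eqxx addn1 exprS -mulrA.
by congr (_ * (_ * _)); apply: eq_bigr => j ji; rewrite (negbTE ji) addn0.
Qed.

Lemma mpow_scale z (t : R) a : mpow (t *: z) a = t ^+ mdeg a * mpow z a.
Proof.
rewrite /mpow /mdeg expr_sum -big_split/=; apply: eq_bigr => i _.
by rewrite mxE exprMn.
Qed.

Lemma mfact_gt0 a : (0 < mfact a)%N.
Proof. by rewrite /mfact; apply: prodn_gt0 => i; exact: fact_gt0. Qed.

Lemma leq_mdeg i a : (a i <= mdeg a)%N.
Proof. by rewrite /mdeg (bigD1 i)//= leq_addr. Qed.

Variables (K : nat).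

Lemma mi_surj a : (mdeg a <= K)%N -> exists b : bmindex n K, mi b = a.
Proof.
move=> aK; exists [ffun i => inord (a i)]; apply/funext => i.
by rewrite /mi ffunE inordK// ltnS (leq_trans (leq_mdeg i a)).
Qed.

(** The multi-indices of degree [j + 1] containing [i] are those of the form
    [b + e_i] with [b] of degree [j]. The bound [j < K] keeps the entries of
    [b + e_i] inside the finite index type. *)
Lemma sum_mincr (i : 'I_n) (j : nat) (G : ('I_n -> nat) -> R) : (j < K)%N ->
  (forall a, a i = 0%N -> G a = 0) ->
  \sum_(a : bmindex n K | mdeg (mi a) == j.+1) G (mi a) =
  \sum_(b : bmindex n K | mdeg (mi b) == j) G (mincr i (mi b)).
Proof.
move=> jK G0.
rewrite (bigID (fun a : bmindex n K => mi a i == 0%N))/= big1 ?add0r; last first.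
  by move=> a /andP[_ /eqP ai]; exact: G0.
pose h (b : bmindex n K) : bmindex n K := [ffun l => inord (b l + (l == i))].
(* The bijection b -> b + e_i and its inverse. *)
pose h' (a : bmindex n K) : bmindex n K := [ffun l => inord (a l - (l == i))].
have miI (a b : bmindex n K) : mi a = mi b -> a = b.
  by move=> ab; apply/ffunP => l; apply: val_inj; exact: (congr1 (fun f => f l) ab).
have mih' (a : bmindex n K) : mi (h' a) = fun l => (mi a l - (l == i))%N.
  apply/funext => l; rewrite /mi /h' ffunE inordK//.
  by rewrite (leq_ltn_trans (leq_subr _ _)).
have mih (b : bmindex n K) : mdeg (mi b) = j -> mi (h b) = mincr i (mi b).
  move=> bj; apply/funext => l; rewrite /mi /h ffunE inordK// ltnS.
  have := leq_mdeg l (mincr i (mi b)); rewrite mdeg_mincr bj => /leq_trans; exact.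
have hh' (a : bmindex n K) : mi a i != 0%N -> h (h' a) = a.
  move=> ai; apply/ffunP => l; apply: val_inj; rewrite /h ffunE.
  have -> : (nat_of_ord (h' a l) + (l == i) = a l)%N.
    rewrite -[nat_of_ord (h' a l)]/(mi (h' a) l) mih'.
    case: eqP => [->|_]; last by rewrite subn0 addn0.
    by rewrite subnK// lt0n.
  by rewrite /= inordK.
rewrite (reindex_onto h h'); last by move=> a /andP[_]; exact: hh'.
apply: eq_big => [b|b].
  apply/idP/idP => [/andP[/andP[/eqP hb hbi] /eqP bE]|/eqP bj].
    have := mih' (h b); rewrite bE => bE'.
    have : mi (h b) = mincr i (mi b).
      apply/funext => l; rewrite /mincr bE'; case: eqP => [->|_]; last by rewrite subn0 addn0.
      by rewrite subnK// lt0n.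
    by move=> /(congr1 (@mdeg n)); rewrite mdeg_mincr hb => -[->].
  rewrite mih// mdeg_mincr bj eqxx/= /mincr eqxx addn1/=.
  apply/eqP; apply: miI; rewrite mih' mih//; apply/funext => l.
  by rewrite /mincr addnK.
move=> /andP[/andP[/eqP hb hbi] /eqP bE].
congr G; have := mih' (h b); rewrite bE => bE'.
apply/funext => l; rewrite /mincr bE'; case: eqP => [->|_]; last by rewrite subn0 addn0.
by rewrite subnK// lt0n.
Qed.

Definition taylor_term (j : nat) (V : ('I_n -> nat) -> 'rV[R]_n -> R) (x z : 'rV[R]_n) : R :=
  \sum_(a : bmindex n K | mdeg (mi a) == j) V (mi a) x / (mfact (mi a))%:R * mpow z (mi a).

(** Remainders are formed for an arbitrary family [V] indexed by
    multi-indices, standing for the derivatives of one function. Passing to a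
    partial derivative only shifts the family, which is what lets the induction on
    the order go through. The index type is fixed by [K], whatever the order [k]. *)
Definition taylor_rem (k : nat) (V : ('I_n -> nat) -> 'rV[R]_n -> R) (x z : 'rV[R]_n) : R :=
  V (fun=> 0%N) (x + z) - \sum_(j < k.+1) taylor_term j V x z.

Definition shift_family i (V : ('I_n -> nat) -> 'rV[R]_n -> R) := fun a => V (mincr i a).

Lemma taylor_term_scale j V x z t :
  taylor_term j V x (t *: z) = t ^+ j * taylor_term j V x z.
Proof.
rewrite /taylor_term mulr_sumr; apply: eq_bigr => a /eqP aj.
by rewrite mpow_scale aj mulrCA.
Qed.

(** Euler's identity for homogeneous polynomials of degree [j + 1]: write
    [j + 1] as the sum of the entries of each multi-index and reindex by [sum_mincr]. *)
Lemma taylor_termS j V x z : (j < K)%N ->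
  j.+1%:R * taylor_term j.+1 V x z = \sum_i z ord0 i * taylor_term j (shift_family i V) x z.
Proof.
move=> jK.
pose G i a := (a i)%:R * (V a x / (mfact a)%:R * mpow z a).
transitivity (\sum_i \sum_(a : bmindex n K | mdeg (mi a) == j.+1) G i (mi a)).
  rewrite exchange_big/= /taylor_term mulr_sumr; apply: eq_bigr => a /eqP aj.
  rewrite -aj /mdeg natr_sum mulr_suml; exact: eq_bigr.
apply: eq_bigr => i _; rewrite (@sum_mincr i j (G i))//; last by move=> a ai; rewrite /G ai mul0r.
rewrite /taylor_term mulr_sumr; apply: eq_bigr => b _.
rewrite /G mfact_mincr mpow_mincr /shift_family {1}/mincr eqxx addn1 natrM.
have f0 : (mfact (mi b))%:R != 0 :> R by rewrite pnatr_eq0 -lt0n mfact_gt0.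
have b0 : (mi b i).+1%:R != 0 :> R by rewrite pnatr_eq0.
by field; rewrite f0 nat1r b0.
Qed.

Lemma taylor_term0 V x z : taylor_term 0 V x z = V (fun=> 0%N) x.
Proof.
have z0 : (mdeg ((fun=> 0%N) : 'I_n -> nat) <= K)%N by rewrite /mdeg big1.
have [b bE] := mi_surj z0.
rewrite /taylor_term (bigD1 b)/=; last by rewrite bE /mdeg big1.
rewrite big1 ?addr0.
  rewrite bE /mfact /mpow !big1 ?divr1 ?mulr1//.
move=> a /andP[/eqP a0 ab]; exfalso; move/eqP: ab; apply.
apply/ffunP => l; apply: val_inj.
have := leq_mdeg l (mi a); rewrite a0 leqn0 => /eqP al.
by rewrite -[LHS]/(mi a l) al -[RHS]/(mi b l) bE.
Qed.

Lemma taylor_sum_terms k V x z :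
  \sum_(j < k.+1) taylor_term j V x z =
  \sum_(a : bmindex n K | (mdeg (mi a) <= k)%N) V (mi a) x / (mfact (mi a))%:R * mpow z (mi a).
Proof.
rewrite [RHS](partition_big (fun a : bmindex n K => inord (mdeg (mi a)) : 'I_k.+1) predT)//=.
apply: eq_bigr => j _; apply: eq_bigl => a.
apply/idP/idP => [/eqP aj|/andP[ak /eqP]].
  by rewrite aj -ltnS ltn_ord/=; apply/eqP/val_inj; rewrite /= inordK.
by move=> <-; rewrite inordK.
Qed.

End multi_index_combinatorics.

(** * Taylor remainders *)

Section tensor_weak.
Context {R : realType} {n : nat}.
Local Notation mu := (lebesgue_rV R n).
Implicit Types (u v w S : 'rV[R]_n -> R) (x z : 'rV[R]_n) (a : 'I_n -> nat).

(** Weak differentiation tested on tensor products only. Under this weaker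
    requirement derivatives can be composed ([tensor_weak_mincr]) since
    differentiations of a tensor product commute. *)
Definition tensor_weak a u v := forall phi, tensor_test phi ->
  \int[mu]_x (u x * tensor (tensor_derive a phi) x) =
  (-1) ^+ mdeg a * \int[mu]_x (v x * tensor phi x).

Lemma weak_derivative_tensor_weak a u v : is_weak_derivative a u v -> tensor_weak a u v.
Proof.
move=> [_ _ h] phi tphi; rewrite -h; last exact: test_function_tensor.
by apply: eq_Rintegral => x _; rewrite mderive_tensor.
Qed.

Lemma tensor_weak0 u : tensor_weak (fun=> 0%N) u u.
Proof. by move=> phi tphi; rewrite /mdeg big1// expr0 mul1r. Qed.

Lemma tensor_weak_mincr i a u v w : tensor_weak a u v -> tensor_weak (mincr i a) u w -> tensor_weak (munit i) v w.
Proof.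
move=> uv uw phi tphi; have tp := tensor_test_derive (munit i) tphi.
have := uw _ tphi; rewrite mdeg_mincr.
rewrite (_ : tensor_derive (mincr i a) phi = tensor_derive a (tensor_derive (munit i) phi)); last first.
  by apply/funext => j; rewrite /tensor_derive /mincr /munit /derive1n iterD.
rewrite uv// exprS -mulrA mulrCA mdeg_munit expr1 => /(congr1 (fun t => (-1) ^+ mdeg a * t)).
by rewrite !mulrA -!exprMn mulrNN mulr1 expr1n !mul1r.
Qed.

Lemma tensor_weak_dir z v (w : 'I_n -> 'rV[R]_n -> R) : cube_integrable v -> (forall i, cube_integrable (w i)) ->
  (forall i, tensor_weak (munit i) v (w i)) ->
  dir_weak_derivative z v (fun x => \sum_(i < n) z ord0 i * w i x).
Proof.
move=> iv iw vw phi tphi.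
have sumE (F : 'I_n -> 'rV[R]_n -> R) : (forall i, mu.-integrable setT (EFin \o F i)) ->
    \int[mu]_x (\sum_i F i x) = \sum_i \int[mu]_x (F i x).
  move=> iF; rewrite /Rintegral.
  under eq_integral do rewrite -sumEFin.
  rewrite (@integral_sum _ _ _ mu setT measurableT _ (fun i x => (F i x)%:E))//.
  rewrite -sum_fine//; first by move=> i _; exact: integrable_fin_num (iF i).
have i1 i : mu.-integrable setT (EFin \o (fun x => v x * tensor (tensor_derive (munit i) phi) x)).
  by apply: integrable_mul_tensor => //; exact: tensor_test_derive.
have i2 i : mu.-integrable setT (EFin \o (fun x => w i x * tensor phi x)).
  exact: integrable_mul_tensor.
have i1' i : mu.-integrable setT (EFin \o (fun x => z ord0 i * (v x * tensor (tensor_derive (munit i) phi) x))).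
  by apply: eq_integrable (integrableZl measurableT (z ord0 i) (i1 i)).
have i2' i : mu.-integrable setT (EFin \o (fun x => z ord0 i * (w i x * tensor phi x))).
  by apply: eq_integrable (integrableZl measurableT (z ord0 i) (i2 i)).
transitivity (\sum_i \int[mu]_x (z ord0 i * (v x * tensor (tensor_derive (munit i) phi) x))).
  rewrite -sumE//; apply: eq_Rintegral => x _.
  by rewrite /dir_tensor mulr_sumr; apply: eq_bigr => i _; rewrite mulrCA.
transitivity (- \sum_i \int[mu]_x (z ord0 i * (w i x * tensor phi x))).
  rewrite -sumrN; apply: eq_bigr => i _.
  by rewrite !RintegralZl// vw// mdeg_munit expr1 mulN1r mulrN.
congr (- _); rewrite -sumE//; apply: eq_Rintegral => x _.
by rewrite mulr_suml; apply: eq_bigr => i _; rewrite mulrA.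
Qed.

End tensor_weak.

Section taylor_bound.
Context {R : realType} {n : nat}.
Local Notation mu := (lebesgue_rV R n).
Variable K : nat.
Implicit Types (V : ('I_n -> nat) -> 'rV[R]_n -> R) (x z : 'rV[R]_n).

Lemma measurable_taylor_term j V z :
  (forall a, mdeg a = j -> measurable_fun setT (V a)) ->
  measurable_fun setT (fun x => taylor_term K j V x z).
Proof.
move=> mV; rewrite /taylor_term.
under eq_fun do rewrite big_mkcond.
apply: measurable_sum => a; case: eqP => [aj|_]; last exact: measurable_cst.
by do 2 apply: measurable_funM => //; exact: mV.
Qed.

Lemma measurable_taylor_rem k V z :
  (forall a, (mdeg a <= k)%N -> measurable_fun setT (V a)) ->
  measurable_fun setT (fun x => taylor_rem K k V x z).
Proof.
move=> mV; apply: measurable_funB.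
  apply: measurableT_comp (measurable_rV_shift z).
  by apply: mV; rewrite /mdeg big1.
apply: measurable_sum => j; apply: measurable_taylor_term => a aj.
by apply: mV; rewrite aj -ltnS.
Qed.

Lemma taylor_rem_segment k V x z (t : R) : (k < K)%N ->
  \sum_i z ord0 i * taylor_rem K k (shift_family i V) x (t *: z) =
  \sum_i z ord0 i * V (munit i) (x + t *: z) -
  \sum_(j < k.+1) t ^+ j * (j.+1%:R * taylor_term K j.+1 V x z).
Proof.
move=> kK; rewrite /taylor_rem.
under eq_bigr do rewrite mulrBr; rewrite sumrB; congr (_ - _).
under eq_bigr do rewrite mulr_sumr; rewrite exchange_big/=.
apply: eq_bigr => j _; rewrite taylor_termS; last by rewrite (leq_trans (ltn_ord j)).
rewrite mulr_sumr; apply: eq_bigr => i _.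
by rewrite taylor_term_scale mulrCA.
Qed.

(** The right-hand side is [p(1) - p(0)] for the polynomial [p] with
    coefficients [c j] in degrees [j + 1], whose derivative is the integrand. *)
Lemma integral_poly_unit (c : nat -> R) k :
  unit_prob.-integrable setT (fun t : R => (\sum_(j < k) t ^+ j * (j.+1%:R * c j))%:E) /\
  (\int[unit_prob]_t (\sum_(j < k) t ^+ j * (j.+1%:R * c j))%:E = (\sum_(j < k) c j)%:E)%E.
Proof.
pose p : {poly R} := \sum_(j < k) (c j)%:P * 'X^(j.+1).
have fE : (fun t : R => \sum_(j < k) t ^+ j * (j.+1%:R * c j)) = (fun t => (p^`()%R).[t]).
  apply/funext => t; rewrite /p raddf_sum/= horner_sum; apply: eq_bigr => j _.
  rewrite derivM derivC mul0r add0r derivXn hornerM hornerMn hornerXn hornerC.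
  have E (a b d : R) : a * (b * d) = d * (b * a) by ring.
  by rewrite E -[X in _ = _ * X]mulr_natl.
have cf : continuous (fun t : R => (p^`()%R).[t]) by exact: continuous_horner.
have mf : measurable_fun setT (fun t : measurableTypeR R => ((p^`()%R).[t])%:E).
  by apply/measurable_EFinP; exact: continuous_measurable_fun.
rewrite [X in unit_prob.-integrable _ X](_ : _ = (fun t : R => ((p^`()%R).[t])%:E)); last first.
  by apply/funext => t; rewrite -(congr1 (fun f => f t) fE).
split.
  apply/integrableP; split => //.
  rewrite integral_unit_prob; last exact: measurableT_comp.
  have : (@lebesgue_measure R).-integrable `[0, 1]%classic (EFin \o (fun t : R => (p^`()%R).[t])).
    apply: continuous_compact_integrable; first exact: segment_compact.
    exact: continuous_subspaceT.
  by case/integrableP.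
under eq_integral => t _ do rewrite (congr1 (fun f => f t) fE).
rewrite (@integral_unit_prob_derive _ (horner p)) //.
congr EFin; rewrite /p !horner_sum -sumrB; apply: eq_bigr => j _.
by rewrite !hornerM !hornerXn !hornerC expr1n expr0n/= mulr0 subr0 mulr1.
Qed.

(** The remainder of order [k + 1] at [z] is the average over [t] in [0, 1] of
    [sum_i z_i * (remainder of order k of the i-th partial derivative at t z)]:
    the function itself contributes by [weak_FTC], the polynomial part by
    [taylor_termS]. Minkowski's integral inequality and induction reduce everything
    to differences of top-order derivatives, which is the case [k = 0]. *)
Lemma taylor_bound p k V z (M Y : R) : (1 <= p)%E -> (k <= K)%N ->
  (forall a, (mdeg a <= k)%N -> cube_integrable (V a)) ->
  (forall a i, (mdeg a < k)%N -> tensor_weak (munit i) (V a) (V (mincr i a))) ->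
  (forall i, `|z ord0 i| <= Y) -> 0 <= Y -> 0 <= M ->
  (forall a (t : R), mdeg a = k -> 0 <= t <= 1 ->
    ('N[mu]_p[EFin \o (fun x => V a (x + t *: z) - V a x)%R] <= M%:E)%E) ->
  ('N[mu]_p[EFin \o (fun x => taylor_rem K k V x z)] <= ((n%:R * Y) ^+ k * M)%:E)%E.
Proof.
move=> p1; elim: k V z M => [|k IH] V z M kK iV wV zY Y0 M0 H.
  rewrite expr0 mul1r; apply: le_trans (H (fun=> 0%N) 1 _ _); last 2 first.
  - by rewrite /mdeg big1.
  - by rewrite ler01 lexx.
  rewrite scale1r le_eqVlt; apply/orP; left; apply/eqP; apply: eq_Lnorm => x /=.
  by rewrite /taylor_rem big_ord1 taylor_term0.
pose S x := \sum_i z ord0 i * V (munit i) x.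
have iV1 i : cube_integrable (V (munit i)) by apply: iV; rewrite mdeg_munit.
have iS : cube_integrable S.
  by apply: cube_integrable_sum => i; exact: cube_integrableZ.
have [mS _] := iS.
have iV0 : cube_integrable (V (fun=> 0%N)) by apply: iV; rewrite /mdeg big1.
have dw : dir_weak_derivative z (V (fun=> 0%N)) S.
  apply: tensor_weak_dir => // i.
  have := wV (fun=> 0%N) i; rewrite {1}/mdeg big1// => /(_ isT).
  by rewrite (_ : mincr i _ = munit i).
have mT j : (j <= k.+1)%N -> measurable_fun setT (fun x => taylor_term K j V x z).
  by move=> jk; apply: measurable_taylor_term => a aj; case: (iV a); rewrite ?aj.
pose F (q : 'rV[R]_n * measurableTypeR R) := S (q.1 + (q.2 : R) *: z) -
  \sum_(j < k.+1) (q.2 : R) ^+ j * (j.+1%:R * taylor_term K j.+1 V q.1 z).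
have FE x t : F (x, t) = \sum_i z ord0 i * taylor_rem K k (shift_family i V) x (t *: z).
  by rewrite taylor_rem_segment.
have mF : measurable_fun setT F.
  apply: measurable_funB; first exact: measurableT_comp mS (measurable_segment z).
  apply: measurable_sum => j; apply: measurable_funM.
    by apply: measurable_funX; exact: measurable_snd.
  apply: measurable_funM => //.
  have mTj := mT j.+1 (ltn_ord j).
  exact: measurableT_comp mTj measurable_fst.
apply: (@Lnorm_integral_le _ _ _ _ _ _ (@unit_prob R) _ _ F) => //.
- by rewrite mulr_ge0// exprn_ge0// mulr_ge0.
- by apply: measurable_taylor_rem => a ak; case: (iV a ak).
- have := @ae_unit_prob R; apply: (@filterS _ _ (ae_filter_ringOfSetsType _)) => t t01.
  have mR i : measurable_fun setT (fun x => taylor_rem K k (shift_family i V) x (t *: z)).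
    by apply: measurable_taylor_rem => a ak; case: (iV (mincr i a)) => //; rewrite mdeg_mincr.
  rewrite (_ : EFin \o _ = EFin \o (fun x => \sum_i z ord0 i * taylor_rem K k (shift_family i V) x (t *: z))); last first.
    by apply/funext => x /=; rewrite FE.
  apply: le_trans (@Lnorm_sum _ _ _ mu p _ _ (fun i x => z ord0 i * taylor_rem K k (shift_family i V) x (t *: z)) p1 _) _.
    by move=> i; exact: measurable_funM.
  have zR i : ('N[mu]_p[EFin \o (fun x => z ord0 i * taylor_rem K k (shift_family i V) x (t *: z))%R]
      <= (Y * ((n%:R * Y) ^+ k * M))%:E)%E.
    rewrite Lnorm_scale// EFinM; apply: lee_pmul; rewrite ?lee_fin ?Lnorm_ge0//.
    apply: IH => //.
    + exact: ltnW.
    + by move=> a ak; apply: iV; rewrite mdeg_mincr.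
    + move=> a j ak; rewrite /shift_family.
      rewrite (_ : mincr i (mincr j a) = mincr j (mincr i a)); last first.
        by apply/funext => l; rewrite /mincr addnAC.
      by apply: wV; rewrite mdeg_mincr.
    + move=> j; rewrite mxE normrM; have /andP[t0 t1] := t01.
      by rewrite ger0_norm// (le_trans _ (zY j))// ler_piMl.
    + move=> a s ak s01; rewrite scalerA; apply: H; first by rewrite mdeg_mincr ak.
      have /andP[t0 t1] := t01; have /andP[s0 s1] := s01.
      by rewrite mulr_ge0//= mulr_ile1.
  apply: le_trans (lee_sum _ (fun i _ => zR i)) _.
  rewrite sumEFin lee_fin sumr_const card_ord -[_ *+ n]mulr_natl exprS.
  by rewrite !mulrA.
- have := ae_segment_integrable z iS; have := weak_FTC iS dw iV0.
  apply: filterS2 => x xE xi.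
  have [ip pE] := integral_poly_unit (fun j => taylor_term K j.+1 V x z) k.+1.
  have FI : (\int[unit_prob]_t (F (x, t))%:E = (taylor_rem K k.+1 V x z)%:E)%E.
    rewrite /F /=; under eq_integral do rewrite EFinB.
    rewrite integralB// pE.
    rewrite -[X in (X - _)%E]fineK; last exact: integrable_fin_num xi.
    rewrite -EFinB; congr EFin; rewrite /taylor_rem [X in _ = _ - X]big_ord_recl /= taylor_term0.
    move: xE; rewrite /segment_mean /Rintegral => <-.
    by rewrite opprD addrA.
  rewrite -FI; apply: le_abse_integral => //.
  apply/measurable_EFinP; exact: measurableT_comp mF (measurable_pair1 x).
Qed.

End taylor_bound.

(** * Averages over boxes *)

Section enorm.
Context {R : realType} {n : nat}.
Implicit Types (x h z : 'rV[R]_n).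

Lemma enorm_ge0 x : 0 <= enorm x.
Proof. exact: sqrtr_ge0. Qed.

Lemma enormN x : enorm (- x) = enorm x.
Proof. by congr Num.sqrt; apply: eq_bigr => i _; rewrite mxE sqrrN. Qed.

Lemma enormZ (t : R) x : enorm (t *: x) = `|t| * enorm x.
Proof.
rewrite /enorm -sqrtr_sqr -sqrtrM ?sqr_ge0// mulr_sumr.
by congr Num.sqrt; apply: eq_bigr => i _; rewrite mxE exprMn.
Qed.

Lemma ler_coord_enorm x i : `|x ord0 i| <= enorm x.
Proof.
rewrite /enorm -sqrtr_sqr ler_wsqrtr// (bigD1 i)//= lerDl.
by apply: sumr_ge0 => j _; exact: sqr_ge0.
Qed.

Lemma ler_enorm_sum x : enorm x <= \sum_i `|x ord0 i|.
Proof.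
rewrite -(ger0_norm (sumr_ge0 _ (fun i _ => normr_ge0 (x ord0 i)))) -sqrtr_sqr.
apply: ler_wsqrtr; elim: (index_enum 'I_n) => [|i s IH].
  by rewrite !big_nil expr0n.
rewrite !big_cons sqrrD (le_trans (lerD (le_refl _) IH))// real_normK ?num_real//.
rewrite -addrA lerD2l lerDr mulrn_wge0// mulr_ge0//.
by apply: sumr_ge0.
Qed.

Lemma ler_enorm x (M : R) : (forall i, `|x ord0 i| <= M) -> enorm x <= n%:R * M.
Proof.
move=> xM; apply: le_trans (ler_enorm_sum x) _.
by rewrite (le_trans (ler_sum _ (fun i _ => xM i)))// sumr_const card_ord mulr_natl.
Qed.

Lemma enorm_eq0 x : enorm x = 0 -> x = 0.
Proof.
move=> x0; apply/rowP => i; rewrite mxE; apply/eqP.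
by rewrite -normr_le0 -x0 ler_coord_enorm.
Qed.

Lemma measurable_enorm : measurable_fun [set: 'rV[R]_n] (@enorm R n).
Proof.
apply: measurableT_comp.
  by apply: continuous_measurable_fun; exact: sqrt_continuous.
by apply: measurable_sum => i; apply: measurable_funX; exact: measurable_coord.
Qed.

End enorm.

Section box_average.
Context {R : realType} {n : nat}.
Local Notation mu := (lebesgue_rV R n).
Implicit Types (x h z : 'rV[R]_n).
Hypothesis n1 : (0 < n)%N.

Definition annulus (t : R) : set 'rV[R]_n :=
  [set h | 3 * t <= enorm h <= 9 * n%:R * t].

Lemma measurable_annulus t : measurable (annulus t).
Proof.
have := @measurable_enorm R n measurableT `[3 * t, 9 * n%:R * t]%classic (measurable_itv _).
by rewrite setTI.
Qed.

(** A box with sides of length [4 t]. Its measure is explicit and it sits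
    inside an annulus, even after a translation of length at most [t]; it replaces
    polar coordinates. *)
Definition shell (t : R) : set 'rV[R]_n := [set h | forall i, `[4 * t, 8 * t]%classic (h ord0 i)].

Lemma measurable_shell t : measurable (shell t).
Proof. by case: (@lebesgue_rV_box R n (fun=> `[4 * t, 8 * t]%classic) (fun=> measurable_itv _)). Qed.

Lemma mu_shell t : 0 < t -> mu (shell t) = ((4 * t) ^+ n)%:E.
Proof.
move=> t0; case: (@lebesgue_rV_box R n (fun=> `[4 * t, 8 * t]%classic) (fun=> measurable_itv _)) => _ ->.
rewrite (eq_bigr (fun=> (4 * t)%:E)) => [|i _].
  by rewrite prodEFin prodr_const card_ord.
rewrite lebesgue_measure_itv/= lte_fin ifT; last by lra.
by rewrite -EFinB; congr EFin; lra.
Qed.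

Lemma shell_annulus t z h : 0 < t -> enorm z <= t -> shell t h -> annulus t (h - z).
Proof.
move=> t0 zt hB.
have zi i := le_trans (ler_coord_enorm z i) zt.
have hi i : 3 * t <= `|(h - z) ord0 i| <= 9 * t.
  have := zi i; have := hB i; rewrite /= in_itv/= !mxE => /andP[h1 h2].
  rewrite ler_norml => /andP[z1 z2].
  rewrite ger0_norm; last by lra.
  by apply/andP; split; lra.
apply/andP; split.
  by have /andP[h1 _] := hi (Ordinal n1); apply: le_trans h1 (ler_coord_enorm _ _).
rewrite -mulrA mulrCA; apply: ler_enorm => i.
by have /andP[] := hi i.
Qed.

Local Open Scope ereal_scope.

(** Average over [h] in the shell the bound of [c] by the sum of the values at
    [h] and at [h - z]. *)
Lemma box_average (t : R) z (Psi : 'rV[R]_n -> \bar R) (c : \bar R) :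
  (0 < t)%R -> (enorm z <= t)%R -> measurable_fun setT Psi -> (forall h, 0 <= Psi h) ->
  0 <= c ->
  (forall h, annulus t h -> annulus t (h - z)%R -> c <= Psi h + Psi (h - z)%R) ->
  c * ((4 * t) ^+ n)%:E <= 2%:E * \int[mu]_(h in annulus t) Psi h.
Proof.
move=> t0 zt mPsi Psi0 c0 H.
have mB := measurable_shell t; have mA := measurable_annulus t.
have mPz : measurable_fun setT (fun h => Psi (h - z)%R).
  exact: measurableT_comp mPsi (measurable_rV_shift _).
have BA h : shell t h -> annulus t h.
  move=> hB; rewrite -[h]subr0; apply: shell_annulus => //.
  by rewrite /enorm big1 ?sqrtr0 ?ltW// => i _; rewrite mxE expr0n.
have BAz h : shell t h -> annulus t (h - z)%R by exact: shell_annulus.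
rewrite -(mu_shell t0) -integral_cst//.
apply: (@le_trans _ _ (\int[mu]_(h in shell t) (Psi h + Psi (h - z)%R))).
  apply: ge0_le_integral => //.
  - by apply: measurable_funTS; exact: emeasurable_funD.
  - by move=> h hB; apply: H; [exact: BA|exact: BAz].
rewrite ge0_integralD//; [|exact: measurable_funTS..].
rewrite (_ : 2%:E = 1 + 1)// ge0_muleDl// !mul1e; apply: leeD.
  by apply: ge0_subset_integral => //; exact: measurable_funTS.
rewrite integral_mkcond [leRHS]integral_mkcond.
rewrite -[leRHS](ge0_integral_translation (- z)%R); last 2 first.
- by apply: (measurable_restrictT _ mA).1; exact: measurable_funTS.
- by move=> h; rewrite patchE; case: ifP.
apply: ge0_le_integral => //.
- by move=> h _; rewrite patchE; case: ifP.
- by apply: (measurable_restrictT _ mB).1; exact: measurable_funTS.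
- apply: measurableT_comp (measurable_rV_shift _).
  by apply: (measurable_restrictT _ mA).1; exact: measurable_funTS.
move=> h _; rewrite !patchE; case: ifPn => [/set_mem hB|_].
  by rewrite mem_set//; exact: BAz.
by case: ifP.
Qed.

End box_average.

(** * The modulus of continuity and the Gagliardo seminorm *)

Section differences.
Context {R : realType} {n : nat}.
Local Notation mu := (lebesgue_rV R n).
Implicit Types (x h z : 'rV[R]_n) (p : \bar R).
Variable v : 'rV[R]_n -> R.
Hypothesis mv : measurable_fun setT v.
Local Open Scope ereal_scope.

Definition modulus p h := 'N[mu]_p[EFin \o (fun x => v (x + h) - v x)%R].

Lemma measurable_diff h : measurable_fun setT (fun x => v (x + h) - v x)%R.
Proof. by apply: measurable_funB => //; exact: measurableT_comp mv (measurable_rV_shift h). Qed.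

Lemma modulusD p h z : 1 <= p -> modulus p (h + z)%R <= modulus p h + modulus p z.
Proof.
move=> p1; rewrite /modulus.
have -> : 'N[mu]_p[EFin \o (fun x => v (x + z) - v x)%R] =
    'N[mu]_p[EFin \o (fun x => v (x + h + z) - v (x + h))%R].
  rewrite -(Lnorm_translation h (f := EFin \o (fun x => v (x + z) - v x)%R))//.
  by apply/measurable_EFinP; exact: measurable_diff.
have mz : measurable_fun setT (fun x => v (x + h + z) - v (x + h))%R.
  exact: measurableT_comp (measurable_diff z) (measurable_rV_shift h).
apply: le_trans (@eminkowski _ _ _ mu _ _ _ (measurable_diff h) mz p1).
rewrite le_eqVlt; apply/orP; left; apply/eqP; apply: eq_Lnorm => x /=; congr EFin.
by rewrite addrA; ring.
Qed.

Lemma modulus0 p : 1 <= p -> modulus p 0%R = 0.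
Proof.
move=> p1; rewrite /modulus (_ : EFin \o _ = cst 0).
  by rewrite Lnorm0//; apply: contraTneq p1 => ->; rewrite -ltNge lte01.
by apply/funext => x /=; rewrite addr0 subrr.
Qed.

(** Subadditivity of the modulus, together with translation invariance, makes
    differences over long steps controlled by short ones. *)
Lemma modulusMn p h m : 1 <= p -> modulus p (m%:R *: h)%R <= m%:R%:E * modulus p h.
Proof.
move=> p1; elim: m => [|m IH]; first by rewrite scale0r mul0e modulus0.
rewrite -natr1 scalerDl scale1r EFinD ge0_muleDl// mul1e.
by apply: le_trans (modulusD _ _ p1) _; rewrite leeD2r.
Qed.

Lemma measurable_add2 : measurable_fun [set: 'rV[R]_n * 'rV[R]_n] (fun q => q.1 + q.2)%R.
Proof.
apply/measurable_fun_rVP => i; under eq_fun do rewrite mxE.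
apply: measurable_funD.
  exact: measurableT_comp (measurable_coord i) measurable_fst.
exact: measurableT_comp (measurable_coord i) measurable_snd.
Qed.

Lemma measurable_diff2 : measurable_fun [set: 'rV[R]_n * 'rV[R]_n] (fun q => v (q.1 + q.2) - v q.1)%R.
Proof.
apply: measurable_funB; first exact: measurableT_comp mv measurable_add2.
exact: measurableT_comp mv measurable_fst.
Qed.

End differences.

Section geometric.
Context {R : realType}.
Local Open Scope ereal_scope.

(** The sum of the geometric series of ratio [exp(-a)] is at least [1 / a];
    a partial sum whose last power is below [1/2] already gives half of it. This is
    where the factor [s] or [1 - s] comes from, with [a] proportional to it. *)
Lemma geometric_lower (a : R) (Phi G B : \bar R) (I : nat -> \bar R) :
  (0 < a)%R -> 0 <= Phi -> 0 <= B -> (forall j, 0 <= I j) ->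
  (forall j, (expR (- a) ^+ j)%:E * Phi <= B * I j) ->
  (forall N, \sum_(j < N) I j <= G) ->
  Phi <= (2 * a)%:E * (B * G).
Proof.
move=> a0 Phi0 B0 I0 H HG.
pose th := expR (- a) : R.
have th0 : (0 < th)%R by exact: expR_gt0.
have th1 : (th < 1)%R by rewrite /th expR_lt1 oppr_lt0.
have tha : (1 - th <= a)%R by have := expR_ge1Dx (- a); rewrite -/th; lra.
have [N thN] : exists N, (th ^+ N <= 2^-1)%R.
  have := @cvg_expr R th; rewrite ger0_norm ?ltW// => /(_ th1)/cvgrPdist_le/(_ 2^-1%R).
  rewrite invr_gt0 ltr0n => /(_ isT)[N _ /(_ N (leqnn N))]/=.
  by rewrite sub0r normrN (ger0_norm (exprn_ge0 _ (ltW th0))) => thN; exists N.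
have sumE : (\sum_(j < N) th ^+ j = (1 - th ^+ N) / (1 - th))%R.
  by rewrite -[X in (X / _)%R]opprB subrX1 -mulNr opprB mulrC mulKf// subr_eq0 gt_eqF.
have s2 : ((2 * a)^-1 <= \sum_(j < N) th ^+ j)%R.
  rewrite sumE ler_pdivlMr ?subr_gt0// ler_pdivrMl ?mulr_gt0//.
  have : (0 <= a * (2^-1 - th ^+ N))%R by apply: mulr_ge0; [exact: ltW|rewrite subr_ge0].
  by rewrite mulrBr; lra.
rewrite -lee_pdivrMl ?mulr_gt0//.
apply: (@le_trans _ _ (B * \sum_(j < N) I j)); last exact: lee_wpmul2l.
apply: (@le_trans _ _ ((\sum_(j < N) th ^+ j)%R%:E * Phi)).
  by apply: lee_wpmul2r => //; rewrite lee_fin.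
rewrite -sumEFin ge0_sume_distrl; last by move=> j _; rewrite lee_fin exprn_ge0// ltW.
rewrite ge0_sume_distrr//.
by apply: lee_sum => j _; exact: H.
Qed.

End geometric.

Section gagliardo_estimate.
Context {R : realType} {n : nat}.
Local Notation mu := (lebesgue_rV R n).
Implicit Types (x h z : 'rV[R]_n).
Hypothesis n1 : (0 < n)%N.
Variables (v : 'rV[R]_n -> R) (r s : R).
Hypotheses (mv : measurable_fun setT v) (r1 : 1 <= r) (s0 : 0 < s) (s1 : s < 1).
Local Open Scope ereal_scope.

Let r0 : (0 < r)%R. Proof. exact: lt_le_trans r1. Qed.

(** The [r]-th power of the [L^r] modulus of [v]. The Gagliardo double
    integral is its integral against the weight [gag_weight]
    ([gagliardo_diff_pow]). *)
Definition diff_pow h : \bar R := \int[mu]_x (`|v (x + h)%R - v x| `^ r)%:E.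
Definition gag_weight h : R := (enorm h `^ (n%:R + s * r))^-1.

Let mdr : measurable_fun [set: 'rV[R]_n * 'rV[R]_n]
  (fun q => (`|v (q.1 + q.2)%R - v q.1| `^ r)%:E).
Proof.
apply/measurable_EFinP; apply: (measurableT_comp (measurable_powR r)).
by apply: measurableT_comp => //; exact: measurable_diff2.
Qed.

Lemma diff_pow_ge0 h : 0 <= diff_pow h.
Proof. by apply: integral_ge0 => x _; rewrite lee_fin powR_ge0. Qed.

Lemma measurable_diff_pow : measurable_fun setT diff_pow.
Proof.
have f0 (q : 'rV[R]_n * 'rV[R]_n) : 0 <= (`|v (q.1 + q.2)%R - v q.1| `^ r)%:E.
  by rewrite lee_fin powR_ge0.
exact: (@measurable_fun_fubini_tonelli_G _ _ _ _ _ mu _ mdr f0).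
Qed.

Lemma modulus_diff_pow h : modulus v r%:E h `^ r = diff_pow h.
Proof. by rewrite /modulus poweR_Lnorm ?gt_eqF. Qed.

Lemma measurable_gag_weight : measurable_fun setT gag_weight.
Proof.
rewrite /gag_weight (_ : (fun h => _) = fun h => enorm h `^ (- (n%:R + s * r)))%R.
  by apply: (measurableT_comp (measurable_powR _)); exact: measurable_enorm.
by apply/funext => h; rewrite powRN.
Qed.

Lemma gag_weight_ge0 h : (0 <= gag_weight h)%R.
Proof. by rewrite invr_ge0 powR_ge0. Qed.

Definition gag_energy : \bar R := \int[mu]_h ((gag_weight h)%:E * diff_pow h).

Lemma gagliardo_diff_pow : gagliardo s r v = ((s * (1 - s))%:E * gag_energy) `^ r^-1.
Proof.
rewrite /gagliardo; congr ((_ * _) `^ _).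
pose f (q : 'rV[R]_n * 'rV[R]_n) := ((gag_weight q.2)%:E * (`|v (q.1 + q.2)%R - v q.1| `^ r)%:E).
have mf : measurable_fun setT f.
  apply: emeasurable_funM => //; apply/measurable_EFinP.
  exact: measurableT_comp measurable_gag_weight measurable_snd.
have f0 q : 0 <= f q by rewrite mule_ge0// lee_fin ?gag_weight_ge0 ?powR_ge0.
transitivity (\int[mu]_x \int[mu]_h f (x, h)).
  apply: eq_integral => x _.
  rewrite -(ge0_integral_translation x); last 2 first.
  - apply/measurable_EFinP; apply: measurable_funM.
      apply: (measurableT_comp (measurable_powR r)); apply: measurableT_comp => //.
      exact: measurable_funB.
    rewrite (_ : (fun y => _) = fun y => enorm (x - y) `^ (- (n%:R + s * r)))%R; last first.
      by apply/funext => y; rewrite powRN.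
    apply: (measurableT_comp (measurable_powR _)).
    apply: (measurableT_comp (@measurable_enorm R n)).
    apply/measurable_fun_rVP => i; under eq_fun do rewrite !mxE.
    by apply: measurable_funB => //; exact: measurable_coord.
  - by move=> y; rewrite lee_fin mulr_ge0 ?powR_ge0// invr_ge0 powR_ge0.
  apply: eq_integral => h _; rewrite /f /gag_weight /= -EFinM mulrC; congr (_ * _)%:E.
    by rewrite opprD addrCA subrr addr0 enormN.
  by rewrite distrC (addrC h x).
rewrite fubini_tonelli//; apply: eq_integral => h _.
rewrite /f /= ge0_integralZl ?lee_fin ?gag_weight_ge0//.
  by apply: measurableT_comp mdr (measurable_pair2 _).
Qed.

(** Go from [x] to [x + z] through [x + h]. *)
Lemma diff_pow_triangle z h : diff_pow z <= (2 `^ r)%:E * (diff_pow h + diff_pow (h - z)%R).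
Proof.
have mP k : measurable_fun setT (fun x => (`|v (x + k)%R - v x| `^ r)%:E).
  apply/measurable_EFinP; apply: (measurableT_comp (measurable_powR r)).
  by apply: measurableT_comp => //; exact: measurable_diff.
have -> : diff_pow (h - z)%R = \int[mu]_x (`|v (x + h)%R - v (x + z)%R| `^ r)%:E.
  rewrite /diff_pow -(ge0_integral_translation z (f := fun x =>
    (`|v (x + (h - z))%R - v x| `^ r)%:E))//.
  apply: eq_integral => x _; congr (`|v _ - v _| `^ _)%:E.
  by rewrite -addrA; congr (_ + _)%R; rewrite addrC subrK.
have mP' : measurable_fun setT (fun x => (`|v (x + h)%R - v (x + z)%R| `^ r)%:E).
  apply/measurable_EFinP; apply: (measurableT_comp (measurable_powR r)).
  apply: measurableT_comp => //; apply: measurable_funB.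
    exact: measurableT_comp mv (measurable_rV_shift _).
  exact: measurableT_comp mv (measurable_rV_shift _).
rewrite -ge0_integralD//; [|by move=> *; rewrite lee_fin powR_ge0..].
rewrite -ge0_integralZl ?lee_fin ?powR_ge0//; last 2 first.
- exact: emeasurable_funD.
- by move=> *; rewrite adde_ge0// lee_fin powR_ge0.
apply: ge0_le_integral => //.
- by apply: emeasurable_funM => //; exact: emeasurable_funD.
move=> x _; rewrite -EFinD -EFinM lee_fin.
set a := (`|v (x + h) - v x|)%R; set b := (`|v (x + h) - v (x + z)|)%R.
have ab : (`|v (x + z)%R - v x| <= a + b)%R.
  rewrite (_ : v (x + z) - v x = (v (x + h) - v x) - (v (x + h) - v (x + z)))%R; last by ring.
  exact: ler_normB.
have a0 : (0 <= a)%R by exact: normr_ge0.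
have b0 : (0 <= b)%R by exact: normr_ge0.
have mono (c d : R) : (0 <= c -> c <= d -> c `^ r <= d `^ r)%R.
  by move=> c0 cd; apply: (ge0_ler_powR (ltW r0)); rewrite ?nnegrE// (le_trans c0).
rewrite mulrDr -!powRM//.
have [lab|lba] := leP a b.
  apply: (@le_trans _ _ ((2 * b) `^ r)%R); last by rewrite lerDr powR_ge0.
  by apply: mono => //; lra.
apply: (@le_trans _ _ ((2 * a) `^ r)%R); last by rewrite lerDl powR_ge0.
by apply: mono => //; lra.
Qed.

(** Absorbs the factors [2^(r+1)] and [(9n)^(n+sr)] of [diff_pow_annulus] into
    an [r]-th power, uniformly in [r >= 1] and [s < 1]. *)
Definition annulus_const : R := 4 * (9 * n%:R) ^+ n.+1.

(** A difference of length at most [t] is controlled by the part of the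
    Gagliardo integral at scale [t]: average [diff_pow_triangle] over a shell, and
    use that the weight is at least [(9 n t)^-(n + s r)] on the annulus. *)
Lemma diff_pow_annulus z t : (0 < t)%R -> (enorm z <= t)%R ->
  diff_pow z <= (annulus_const `^ r * t `^ (s * r))%:E * \int[mu]_(h in annulus t) ((gag_weight h)%:E * diff_pow h).
Proof.
move=> t0 zt.
have mA := @measurable_annulus R n t.
have nR : (1 <= n%:R :> R)%R by rewrite ler1n.
pose d : R := (n%:R + s * r)%R.
have d0 : (0 < d)%R by rewrite addr_gt0 ?mulr_gt0// ltr0n.
have := @box_average R n n1 t z (fun h => (2 `^ r)%:E * diff_pow h) (diff_pow z) t0 zt.
move=> /(_ (measurable_funeM _ measurable_diff_pow)).
have P0 h : 0 <= (2 `^ r)%:E * diff_pow h by rewrite mule_ge0 ?lee_fin ?powR_ge0 ?diff_pow_ge0.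
move=> /(_ P0 (diff_pow_ge0 _)).
have H0 h : annulus t h -> annulus t (h - z)%R ->
    diff_pow z <= (2 `^ r)%:E * diff_pow h + (2 `^ r)%:E * diff_pow (h - z)%R.
  by move=> _ _; rewrite -ge0_muleDr ?diff_pow_ge0//; exact: diff_pow_triangle.
move=> /(_ H0).
have mwP : measurable_fun setT (fun h => (gag_weight h)%:E * diff_pow h).
  apply: emeasurable_funM; last exact: measurable_diff_pow.
  by apply/measurable_EFinP; exact: measurable_gag_weight.
have wP0 h : 0 <= (gag_weight h)%:E * diff_pow h by rewrite mule_ge0 ?lee_fin ?gag_weight_ge0 ?diff_pow_ge0.
set J := \int[mu]_(h in annulus t) ((gag_weight h)%:E * diff_pow h).
have J0 : 0 <= J by apply: integral_ge0.
have le1 : \int[mu]_(h in annulus t) ((2 `^ r)%:E * diff_pow h) <=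
    (2 `^ r * (9 * n%:R * t) `^ d)%:E * J.
  rewrite -ge0_integralZl ?lee_fin ?mulr_ge0 ?powR_ge0//; last first.
    exact: measurable_funTS.
  apply: ge0_le_integral => //.
  - by apply: measurable_funTS; apply: measurable_funeM; exact: measurable_diff_pow.
  - by apply: measurable_funTS; exact: measurable_funeM.
  move=> h /andP[h1 h2]; rewrite muleA -EFinM; apply: lee_wpmul2r; first exact: diff_pow_ge0.
  rewrite lee_fin -[leRHS]mulrA ler_peMr ?powR_ge0//.
  have hp : (0 < enorm h)%R by apply: lt_le_trans h1; rewrite mulr_gt0.
  rewrite /gag_weight -/d ler_pdivlMr ?powR_gt0// mul1r.
  by apply: (ge0_ler_powR (ltW d0)); rewrite ?nnegrE ?(ltW hp)// (le_trans (ltW hp)).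
have two0 : 0 <= 2%:E :> \bar R by rewrite lee_fin.
move=> /le_trans /(_ (lee_wpmul2l two0 le1)).
rewrite muleC -lee_pdivlMl ?exprn_gt0 ?mulr_gt0// !muleA -!EFinM => /le_trans; apply.
apply: lee_wpmul2r => //; rewrite lee_fin.
have tE : ((9 * n%:R * t) `^ d = (9 * n%:R) `^ d * (t ^+ n * t `^ (s * r)))%R.
  have n9 : (0 <= 9 * n%:R :> R)%R by rewrite mulr_ge0.
  rewrite (powRM _ n9 (ltW t0)); congr (_ * _)%R.
  rewrite /d powRD; last by rewrite (gt_eqF t0) implybT.
  by rewrite (powR_mulrn _ (ltW t0)).
rewrite tE exprMn.
have -> : ((4 ^+ n * t ^+ n)^-1 * 2 * (2 `^ r * ((9 * n%:R) `^ d * (t ^+ n * t `^ (s * r))))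
   = (4 ^+ n)^-1 * (2 * 2 `^ r * (9 * n%:R) `^ d) * t `^ (s * r))%R.
  by field; rewrite !expf_neq0// gt_eqF.
rewrite ler_wpM2r ?powR_ge0//.
apply: (@le_trans _ _ (2 * 2 `^ r * (9 * n%:R) `^ d)%R).
  rewrite ler_piMl ?mulr_ge0 ?powR_ge0// invf_le1 ?exprn_gt0//.
  by rewrite exprn_ege1// ler1n.
have n9 : (0 <= 9 * n%:R :> R)%R by rewrite mulr_ge0.
rewrite /annulus_const (@powRM _ 4%R) ?exprn_ge0//; apply: ler_pM; rewrite ?mulr_ge0 ?powR_ge0//.
  rewrite (_ : 4 = 2 * 2 :> R)%R ?powRM//; last by ring.
  by rewrite ler_wpM2r ?powR_ge0// le1r_powR// ler1n.
rewrite -powR_mulrn ?mulr_ge0// -powRrM; apply: ler_powR; first lra.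
rewrite /d -natr1 mulrDl mul1r lerD//.
  by rewrite ler_peMr.
by rewrite ler_piMl ?ltW.
Qed.

End gagliardo_estimate.

Section gagliardo_final.
Context {R : realType} {n : nat}.
Local Notation mu := (lebesgue_rV R n).
Implicit Types (x h z y : 'rV[R]_n).
Hypothesis n1 : (0 < n)%N.

Let nR : 1 <= n%:R :> R. Proof. by rewrite ler1n. Qed.

(** Annuli of well separated radii are disjoint. *)
Lemma annuli_sum (tau : nat -> R) (F : 'rV[R]_n -> \bar R) N :
  (forall i j, (i < j)%N -> 9 * n%:R * tau i < 3 * tau j \/ 9 * n%:R * tau j < 3 * tau i) ->
  measurable_fun setT F -> (forall h, 0 <= F h)%E ->
  (\sum_(j < N) \int[mu]_(h in annulus (tau j)) F h <= \int[mu]_h F h)%E.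
Proof.
move=> sep mF F0.
have mA t : measurable (annulus t : set 'rV[R]_n) by exact: measurable_annulus.
rewrite -(big_mkord xpredT (fun j => \int[mu]_(h in annulus (tau j)) F h)%E).
rewrite -ge0_integral_bigsetU//.
- apply: ge0_subset_integral => //; exact: bigsetU_measurable.
- exact: iota_uniq.
- apply/trivIsetP => i j _ _ ij; apply/seteqP; split => // h [/andP[a1 a2] /andP[b1 b2]].
  have : (i < j)%N \/ (j < i)%N by lia.
  by move=> [] /sep []; lra.
- exact: measurable_funTS.
Qed.

(** The ratio of the radii of consecutive scales: annuli have outer radius
    [9n] and inner radius [3], so [4n] separates them; it is an integer because
    [modulusMn] is applied to its powers. *)
Definition ratio : nat := (4 * n)%N.
Local Notation L := (ratio%:R : R).

Let L4 : 4 <= L.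
Proof. by rewrite /ratio natrM ler_peMr. Qed.

Let L0 : 0 < L. Proof. by apply: lt_le_trans L4. Qed.

Let lnL0 : 0 < ln L. Proof. by rewrite ln_gt0//; apply: lt_le_trans L4; rewrite ltr1n. Qed.

Lemma powR_ratio (b : R) j : (L ^+ j) `^ b = expR (b * ln L) ^+ j.
Proof.
rewrite -[in LHS]powR_mulrn ?(ltW L0)// powRAC powR_mulrn ?powR_ge0//.
by rewrite /powR gt_eqF.
Qed.

Lemma annuli_sep (rho : R) i j : 0 < rho -> (i < j)%N ->
  9 * n%:R * (L ^+ i * rho) < 3 * (L ^+ j * rho).
Proof.
move=> rho0 ij; rewrite !mulrA ltr_pM2r//.
apply: (@lt_le_trans _ _ (3 * L ^+ i.+1)).
  rewrite exprS mulrA ltr_pM2r ?exprn_gt0//.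
  by rewrite /ratio natrM mulrA ltr_pM2r ?ltr0n// -natrM ltr_nat.
by rewrite ler_pM2l// ler_weXn2l//; apply: le_trans L4; rewrite ler1n.
Qed.

Variables (v : 'rV[R]_n -> R) (r s : R).
Hypotheses (mv : measurable_fun setT v) (r1 : 1 <= r) (s0 : 0 < s) (s1 : s < 1).
Local Open Scope ereal_scope.
Local Notation Phi := (diff_pow v r).
Local Notation wgt := (gag_weight r s).
Local Notation Kc := (@annulus_const R n).

Let r0 : (0 < r)%R. Proof. exact: lt_le_trans r1. Qed.

Let mwP : measurable_fun setT (fun h => (wgt h)%:E * Phi h).
Proof.
apply: emeasurable_funM; last exact: measurable_diff_pow.
by apply/measurable_EFinP; exact: measurable_gag_weight.
Qed.

Let wP0 h : 0 <= (wgt h)%:E * Phi h.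
Proof. by rewrite mule_ge0 ?lee_fin ?gag_weight_ge0 ?diff_pow_ge0. Qed.

(** The same step [y] is seen at all the scales [L^j |y|]; the ratio of the
    resulting lower bounds is [L^(-s r)]. *)
Lemma diff_pow_large_scales y : y != 0%R ->
  Phi y <= (2 * (s * r * ln L))%:E * ((Kc `^ r * enorm y `^ (s * r))%:E * gag_energy v r s).
Proof.
move=> yN0; pose rho := enorm y.
have rho0 : (0 < rho)%R.
  by rewrite lt_neqAle enorm_ge0 andbT eq_sym; apply: contra yN0 => /eqP/enorm_eq0 ->.
pose I j := \int[mu]_(h in annulus (L ^+ j * rho)%R) ((wgt h)%:E * Phi h).
apply: (@geometric_lower _ _ _ _ _ I).
- by rewrite !mulr_gt0.
- exact: diff_pow_ge0.
- by rewrite lee_fin mulr_ge0 ?powR_ge0.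
- by move=> j; exact: integral_ge0.
- move=> j.
  have yt : (enorm y <= L ^+ j * rho)%R.
    rewrite ler_peMl ?(ltW rho0)// exprn_ege1//; apply: le_trans L4; by rewrite ler1n.
  have t0 : (0 < L ^+ j * rho)%R by rewrite mulr_gt0// exprn_gt0.
  have := diff_pow_annulus n1 mv r1 s0 s1 t0 yt; rewrite -/(I j) => H.
  apply: le_trans (lee_wpmul2l _ H) _; first by rewrite lee_fin exprn_ge0// expR_ge0.
  rewrite muleA -EFinM (@powRM _ (L ^+ j)%R) ?exprn_ge0 ?(ltW L0) ?(ltW rho0)//.
  rewrite powR_ratio.
  have -> (a b c d : R) : (a * (b * (c * d)) = (a * c) * (b * d))%R by ring.
  by rewrite -exprMn -expRD addNr expR0 expr1n mul1r.
- move=> N; apply: (@annuli_sum (fun j => L ^+ j * rho)%R _ N) => // i j ij; left; exact: annuli_sep.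
Qed.

(** The step [y] is [L^j] times the step [L^-j y], seen at scale [L^-j |y|];
    the ratio of the resulting lower bounds is [L^(-(1 - s) r)]. *)
Lemma diff_pow_small_scales y : y != 0%R ->
  Phi y <= (2 * ((1 - s) * r * ln L))%:E * ((Kc `^ r * enorm y `^ (s * r))%:E * gag_energy v r s).
Proof.
move=> yN0; pose rho := enorm y.
have rho0 : (0 < rho)%R.
  by rewrite lt_neqAle enorm_ge0 andbT eq_sym; apply: contra yN0 => /eqP/enorm_eq0 ->.
pose I j := \int[mu]_(h in annulus ((L ^+ j)^-1 * rho)%R) ((wgt h)%:E * Phi h).
apply: (@geometric_lower _ _ _ _ _ I).
- by rewrite !mulr_gt0// subr_gt0.
- exact: diff_pow_ge0.
- by rewrite lee_fin mulr_ge0 ?powR_ge0.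
- by move=> j; exact: integral_ge0.
- move=> j.
  have Lj0 : (0 < L ^+ j)%R by rewrite exprn_gt0.
  pose z := ((L ^+ j)^-1 *: y)%R.
  have zt : (enorm z <= (L ^+ j)^-1 * rho)%R by rewrite enormZ ger0_norm// invr_ge0 ltW.
  have t0 : (0 < (L ^+ j)^-1 * rho)%R by rewrite mulr_gt0// invr_gt0.
  have := diff_pow_annulus n1 mv r1 s0 s1 t0 zt; rewrite -/(I j) => H.
  have yz : Phi y <= ((L ^+ j) `^ r)%:E * Phi z.
    have -> : y = ((ratio ^ j)%N%:R *: z)%R.
      by rewrite /z scalerA natrX mulfV ?scale1r// gt_eqF.
    rewrite -!modulus_diff_pow// -natrX -poweR_EFin -poweRM ?lee_fin ?Lnorm_ge0//.
    apply: lee_poweR; [exact: ltW|exact: Lnorm_ge0|exact: modulusMn].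
  apply: le_trans (lee_wpmul2l _ yz) _; first by rewrite lee_fin exprn_ge0// expR_ge0.
  rewrite muleA -EFinM; apply: le_trans (lee_wpmul2l _ H) _.
    by rewrite lee_fin mulr_ge0 ?powR_ge0// exprn_ge0// expR_ge0.
  rewrite muleA -EFinM le_eqVlt; apply/orP; left; apply/eqP; congr (_%:E * _).
  rewrite (@powRM _ (L ^+ j)^-1%R) ?invr_ge0 ?(ltW Lj0) ?(ltW rho0)//.
  have -> : ((L ^+ j)^-1 `^ (s * r) = expR (- (s * r * ln L)) ^+ j)%R.
    rewrite -powR_inv1 ?(ltW Lj0)// powRAC powR_ratio powR_inv1 ?exprn_ge0 ?expR_ge0//.
    by rewrite expRN exprVn.
  rewrite powR_ratio.
  have -> (a b c d e : R) : (a * b * (c * (d * e)) = (a * b * d) * (c * e))%R by ring.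
  rewrite -!exprMn -!expRD (_ : _ + _ = 0)%R; first by rewrite expR0 expr1n mul1r.
  by ring.
- move=> N; apply: (@annuli_sum (fun j => (L ^+ j)^-1 * rho)%R _ N) => // i j ij; right.
  rewrite -(@ltr_pM2l _ (L ^+ i * L ^+ j)%R) ?mulr_gt0 ?exprn_gt0//.
  have -> : (L ^+ i * L ^+ j * (9 * n%:R * ((L ^+ j)^-1 * rho)) = 9 * n%:R * (L ^+ i * rho))%R.
    by field; rewrite expf_neq0// gt_eqF.
  have -> : (L ^+ i * L ^+ j * (3 * ((L ^+ i)^-1 * rho)) = 3 * (L ^+ j * rho))%R.
    by field; rewrite expf_neq0// gt_eqF.
  exact: annuli_sep.
Qed.

Definition gagliardo_const : R := 4 * expR 1 * L * Kc.

Lemma gagliardo_const_ge0 : (0 <= gagliardo_const)%R.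
Proof.
by rewrite /gagliardo_const !mulr_ge0 ?expR_ge0.
Qed.

(** Large scales lose the factor [s], small scales the factor [1 - s]. The
    better of the two is at most [2 s (1 - s)], which is the normalisation of the
    seminorm. The remaining factor [4 r ln L] is bounded by the [r]-th power of
    [4 e L]. *)
Lemma modulus_gagliardo y :
  modulus v r%:E y <= (gagliardo_const * enorm y `^ s)%:E * gagliardo s r v.
Proof.
have K0 : (0 <= Kc)%R by rewrite mulr_ge0// exprn_ge0// mulr_ge0.
have C0 := gagliardo_const_ge0.
have ga0 : 0 <= gagliardo s r v by exact: poweR_ge0.
have [->|yN0] := eqVneq y 0%R.
  by rewrite modulus0 ?lee_fin// mule_ge0// lee_fin mulr_ge0 ?powR_ge0.
have G0 : 0 <= gag_energy v r s by exact: integral_ge0.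
have ss0 : (0 < s * (1 - s))%R by rewrite mulr_gt0// subr_gt0.
have H : Phi y <= ((gagliardo_const * enorm y `^ s) `^ r)%:E * ((s * (1 - s))%:E * gag_energy v r s).
  set B := (Kc `^ r * enorm y `^ (s * r))%R.
  have B0 : (0 <= B)%R by rewrite mulr_ge0 ?powR_ge0.
  apply: (@le_trans _ _ ((4 * (s * (1 - s)) * r * ln L)%:E * (B%:E * gag_energy v r s))).
    have BG0 : 0 <= B%:E * gag_energy v r s by rewrite mule_ge0.
    have rL : (0 < r * ln L)%R by rewrite mulr_gt0.
    have [sh|hs] : (s <= 1 / 2)%R \/ (1 / 2 <= s)%R.
      by have [|/ltW] := leP s (1 / 2)%R; [left|right].
      apply: le_trans (diff_pow_large_scales yN0) _; apply: lee_wpmul2r => //; rewrite lee_fin.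
      rewrite -subr_ge0.
      have -> : (4 * (s * (1 - s)) * r * ln L - 2 * (s * r * ln L) = 2 * s * (1 - 2 * s) * (r * ln L))%R by ring.
      apply: mulr_ge0; last exact: ltW.
      apply: mulr_ge0; first by rewrite mulr_ge0 ?(ltW s0).
      by rewrite subr_ge0 mulrC -ler_pdivlMr.
    apply: le_trans (diff_pow_small_scales yN0) _; apply: lee_wpmul2r => //; rewrite lee_fin.
    rewrite -subr_ge0.
    have -> : (4 * (s * (1 - s)) * r * ln L - 2 * ((1 - s) * r * ln L) = 2 * (1 - s) * (2 * s - 1) * (r * ln L))%R by ring.
    apply: mulr_ge0; last exact: ltW.
    apply: mulr_ge0; first by rewrite mulr_ge0 ?subr_ge0 ?(ltW s1).
    by rewrite subr_ge0 mulrC -ler_pdivrMr.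
  rewrite !muleA -!EFinM; apply: lee_wpmul2r => //; rewrite lee_fin.
  rewrite powRM ?powR_ge0// -powRrM /gagliardo_const powRM// ?mulr_ge0 ?expR_ge0 ?(ltW L0)//.
  rewrite -/B -subr_ge0.
  have -> : ((4 * expR 1 * L) `^ r * Kc `^ r * enorm y `^ (s * r) * (s * (1 - s)) - 4 * (s * (1 - s)) * r * ln L * B
    = (s * (1 - s)) * B * ((4 * expR 1 * L) `^ r - 4 * r * ln L))%R by rewrite /B; ring.
  rewrite mulr_ge0 ?(mulr_ge0 (ltW ss0))// subr_ge0.
  rewrite powRM ?mulr_ge0 ?expR_ge0 ?(ltW L0)// powRM ?expR_ge0//.
  have x1 : (4 <= 4 `^ r :> R)%R by rewrite le1r_powR// ler1n.
  have x2 : (r <= expR 1 `^ r)%R.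
    by rewrite /powR gt_eqF ?expR_gt0// expRK mulr1; have := expR_ge1Dx r; lra.
  have x3 : (ln L <= L `^ r)%R.
    apply: (@le_trans _ _ L); last by rewrite le1r_powR//; apply: le_trans L4; rewrite ler1n.
    have : (ln (1 + (L - 1)) <= L - 1)%R by apply: le_ln1Dx; rewrite ltrBrDl subrr.
    by rewrite [(1 + _)%R]addrC subrK => /le_trans; apply; rewrite gerBl.
  by apply: ler_pM => //; rewrite ?mulr_ge0 ?(ltW r0) ?(ltW lnL0)//; apply: ler_pM => //; exact: ltW.
have E (x : \bar R) : 0 <= x -> x = (x `^ r) `^ r^-1.
  by move=> x0; rewrite -poweRrM mulfV ?gt_eqF// poweRe1.
rewrite (E (modulus _ _ _)) ?Lnorm_ge0// modulus_diff_pow//.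
have c0 : (0 <= gagliardo_const * enorm y `^ s)%R by rewrite mulr_ge0 ?powR_ge0.
rewrite gagliardo_diff_pow// [X in X * _]E ?lee_fin// -poweRM ?poweR_ge0//; last first.
  by rewrite mule_ge0// lee_fin ltW.
by apply: lee_poweR => //; rewrite ?invr_ge0 ?(ltW r0) ?diff_pow_ge0.
Qed.

End gagliardo_final.

(** * The other seminorms *)

Section modulus_bounds.
Context {R : realType} {n : nat}.
Local Notation mu := (lebesgue_rV R n).
Implicit Types (x h z y : 'rV[R]_n) (p : \bar R) (v : 'rV[R]_n -> R).
Local Open Scope ereal_scope.

Lemma modulus_Lnorm p v y : 1 <= p -> measurable_fun setT v ->
  modulus v p y <= 2%:E * 'N[mu]_p[EFin \o v].
Proof.
move=> p1 mv; have mvy := measurableT_comp mv (measurable_rV_shift y).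
rewrite /modulus (_ : (fun x => _) = (fun x => v (x + y)%R) \+ (fun x => -1 * v x))%R; last first.
  by apply/funext => x /=; rewrite mulN1r.
apply: le_trans (eminkowski mu mvy (measurable_funM (measurable_cst _) mv) p1) _.
rewrite Lnorm_scale// normrN1 mul1e (_ : 2%:E = 1 + 1)// ge0_muleDl// !mul1e.
by rewrite (Lnorm_translation y (f := EFin \o v))//; exact/measurable_EFinP.
Qed.

Lemma modulus_grad p v (w : 'I_n -> 'rV[R]_n -> R) y (M : R) : 1 <= p -> (0 <= M)%R ->
  cube_integrable v -> (forall i, cube_integrable (w i)) ->
  (forall i, tensor_weak (munit i) v (w i)) ->
  'N[mu]_p[(fun x => (enorm (\row_i w i x)%R)%:E)] <= M%:E ->
  modulus v p y <= (n%:R * enorm y * M)%:E.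
Proof.
move=> p1 M0 iv iw vw wM.
pose S x := (\sum_i y ord0 i * w i x)%R.
have iS : cube_integrable S.
  by apply: cube_integrable_sum => i; exact: cube_integrableZ.
have [mS _] := iS; have [mv _] := iv.
have dw : dir_weak_derivative y v S by exact: tensor_weak_dir.
have mw : measurable_fun setT (fun x => \row_i w i x)%R.
  by apply/measurable_fun_rVP => i; under eq_fun do rewrite mxE; case: (iw i).
have me : measurable_fun setT (fun x => enorm (\row_i w i x)%R).
  exact: measurableT_comp (@measurable_enorm R n) mw.
apply: (@Lnorm_integral_le _ _ _ _ _ mu (@unit_prob R) _ _ (fun q => S (q.1 + q.2 *: y)%R)) => //.
- by rewrite !mulr_ge0// enorm_ge0.
- exact: measurableT_comp mS (measurable_segment y).
- exact: measurable_diff.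
- apply: aeW => t.
  rewrite (Lnorm_translation (t *: y)%R (f := EFin \o S))//; last exact/measurable_EFinP.
  rewrite EFinM; apply: le_trans (lee_wpmul2l _ wM); last first.
    by rewrite lee_fin mulr_ge0// enorm_ge0.
  have c0 : (0 <= n%:R * enorm y)%R by rewrite mulr_ge0// enorm_ge0.
  rewrite -[X in X%:E * _]ger0_norm//.
  rewrite -(Lnorm_scale mu (n%:R * enorm y)%R p1 me).
  apply: ae_le_Lnorm => //; first exact: measurable_funM.
  apply: aeW => x; rewrite normrM (ger0_norm c0) (ger0_norm (enorm_ge0 _)).
  rewrite /S (le_trans (ler_norm_sum _ _ _))// -mulrA.
  apply: (@le_trans _ _ (\sum_(i < n) enorm y * enorm (\row_i w i x)%R)%R).
    apply: ler_sum => i _; rewrite normrM; apply: ler_pM => //; first exact: ler_coord_enorm.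
    by have := ler_coord_enorm (\row_i w i x)%R i; rewrite mxE.
  by rewrite sumr_const card_ord mulr_natl.
- have := ae_segment_integrable y iS; have := weak_FTC iS dw iv.
  apply: filterS2 => x xE xi; rewrite xE /segment_mean /Rintegral fineK; last first.
    exact: integrable_fin_num xi.
  apply: le_abse_integral => //; apply/measurable_EFinP.
  exact: measurableT_comp (measurableT_comp mS (measurable_segment y)) (measurable_pair1 x).
Qed.

(** The argument of [diff_pow_annulus] with [|v(x+h) - v(x)|^r] replaced by
    the positive part of [|v(x+h) - v(x)| - M |h|^s], whose integral over all [x] and
    [h] vanishes by hypothesis. The average over a shell passes from almost every
    step [h] to the given step [y]. *)
Lemma modulus_hoelder v (s M : R) y : (0 < n)%N -> (0 <= s)%R -> (0 <= M)%R ->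
  measurable_fun setT v -> hoelder_seminorm s v <= M%:E ->
  modulus v +oo y <= (2 * M * (9 * n%:R * enorm y) `^ s)%:E.
Proof.
move=> n1 s0 M0 mv /ess_supP vM.
have rhs0 : (0 <= 2 * M * (9 * n%:R * enorm y) `^ s)%R by rewrite !mulr_ge0// powR_ge0.
have [->|yN0] := eqVneq y 0%R.
  by rewrite modulus0 ?leey// lee_fin !mulr_ge0// powR_ge0.
pose E (a b : R) : \bar R := (Num.max (a - b) 0)%:E.
have E0 a b : 0 <= E a b by rewrite lee_fin le_max lexx orbT.
have mE d (T : measurableType d) (f g : T -> R) : measurable_fun setT f -> measurable_fun setT g ->
    measurable_fun setT (fun t => E (f t) (g t)).
  by move=> mf mg; apply/measurable_EFinP; apply: measurable_maxr => //; exact: measurable_funB.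
have men (D : 'rV[R]_n -> R) : measurable_fun setT D -> measurable_fun setT (fun x => `|D x|)%R.
  by move=> mD; exact: measurableT_comp.
pose f (q : 'rV[R]_n * 'rV[R]_n) := E `|v q.1 - v q.2|%R (M * enorm (q.1 - q.2) `^ s)%R.
have msub : measurable_fun [set: 'rV[R]_n * 'rV[R]_n] (fun q => q.1 - q.2)%R.
  apply/measurable_fun_rVP => i; under eq_fun do rewrite !mxE.
  apply: measurable_funB.
    exact: measurableT_comp (measurable_coord i) measurable_fst.
  exact: measurableT_comp (measurable_coord i) measurable_snd.
have mf : measurable_fun setT f.
  apply: mE.
    apply: measurableT_comp => //; apply: measurable_funB.
      exact: measurableT_comp mv measurable_fst.
    exact: measurableT_comp mv measurable_snd.
  apply: measurable_funM => //; apply: (measurableT_comp (measurable_powR s)).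
  exact: measurableT_comp (@measurable_enorm R n) msub.
have f0 q : 0 <= f q by exact: E0.
have intf : \int[mu \x mu]_q f q = 0.
  rewrite (ae_eq_integral (cst 0)) ?integral0//.
  apply: filterS vM => q vM _; rewrite /f /E; congr EFin.
  apply/max_idPr; rewrite subr_le0.
  have [q0|q0] := eqVneq (enorm (q.1 - q.2)) 0%R.
    have /eqP := enorm_eq0 q0; rewrite subr_eq0 => /eqP ->.
    by rewrite subrr normr0 mulr_ge0// powR_ge0.
  have qp : (0 < enorm (q.1 - q.2))%R by rewrite lt_neqAle eq_sym q0 enorm_ge0.
  by move: vM; rewrite lee_fin ler_pdivrMr ?powR_gt0.
pose g (q : 'rV[R]_n * 'rV[R]_n) := E `|v (q.1 + q.2) - v q.1|%R (M * enorm q.2 `^ s)%R.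
have mg : measurable_fun setT g.
  apply: mE; first by apply: measurableT_comp => //; exact: measurable_diff2.
  apply: measurable_funM => //; apply: (measurableT_comp (measurable_powR s)).
  exact: measurableT_comp (@measurable_enorm R n) measurable_snd.
have g0 q : 0 <= g q by exact: E0.
pose Psi h := \int[mu]_x g (x, h).
have mPsi : measurable_fun setT Psi by exact: measurable_fun_fubini_tonelli_G.
have Psi0 h : 0 <= Psi h by apply: integral_ge0 => x _; exact: g0.
have intPsi : \int[mu]_h Psi h = 0.
  transitivity (\int[mu \x mu]_q f q); last exact: intf.
  transitivity (\int[mu]_x \int[mu]_h g (x, h)).
    by apply/esym; exact: (fubini_tonelli g mg g0).
  transitivity (\int[mu]_x \int[mu]_h f (x, h)); last by apply/esym; exact: (fubini_tonelli1 f mf f0).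
  apply: eq_integral => x _.
  have mfx : measurable_fun setT (fun h => f (x, h)).
    exact: measurableT_comp mf (measurable_pair1 x).
  transitivity (\int[mu]_h f (x, h + x)%R).
    apply: eq_integral => h _; rewrite /f /g /= distrC (addrC h x).
    by rewrite opprD addrA subrr sub0r enormN.
  exact: (ge0_integral_translation x mfx (fun h => f0 (x, h))).
pose t := enorm y.
have t0 : (0 < t)%R.
  by rewrite lt_neqAle enorm_ge0 andbT eq_sym; apply: contra yN0 => /eqP/enorm_eq0 ->.
pose b : R := (M * (9 * n%:R * t) `^ s)%R.
have mc : measurable_fun setT (fun x => E `|v (x + y) - v x|%R (2 * b)%R).
  by apply: mE => //; apply: men; exact: measurable_diff.
pose c := \int[mu]_x E `|v (x + y) - v x|%R (2 * b)%R.
have c0 : 0 <= c by exact: integral_ge0.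
have gb x h : annulus t h -> E `|v (x + h) - v x|%R b <= g (x, h).
  move=> /andP[h1 h2]; rewrite lee_fin.
  have hb : (M * enorm h `^ s <= b)%R.
    by rewrite ler_wpM2l//; apply: (ge0_ler_powR s0); rewrite ?nnegrE ?enorm_ge0// (le_trans (enorm_ge0 h)).
  by rewrite /= ge_max !le_max lexx orbT lerD2l lerN2 hb.
have H h : annulus t h -> annulus t (h - y)%R -> c <= Psi h + Psi (h - y)%R.
  move=> th thy.
  have mgk k : measurable_fun setT (fun x => g (x, k)) by exact: measurableT_comp mg (measurable_pair2 k).
  have -> : Psi (h - y)%R = \int[mu]_x g (x + y, h - y)%R.
    apply/esym; exact: (ge0_integral_translation y (mgk (h - y)%R) (fun x => g0 (x, h - y)%R)).
  have mgy : measurable_fun setT (fun x => g (x + y, h - y)%R).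
    exact: measurableT_comp (mgk _) (measurable_rV_shift y).
  rewrite -ge0_integralD//; apply: ge0_le_integral => //.
    exact: emeasurable_funD.
  move=> x _; apply: le_trans (leeD (gb _ _ th) (gb _ _ thy)).
  rewrite -EFinD lee_fin (_ : x + y + (h - y) = x + h)%R; last first.
    by rewrite addrACA subrr addr0.
  have := ler_normB (v (x + h) - v x)%R (v (x + h) - v (x + y))%R.
  rewrite opprB addrC addrA subrK => tri.
  rewrite ge_max; apply/andP; split; last by rewrite addr_ge0// le_max lexx orbT.
  apply: (@le_trans _ _ ((`|v (x + h) - v x| - b) + (`|v (x + h) - v (x + y)| - b))%R).
    by lra.
  by apply: lerD; rewrite le_max lexx.
have := @box_average R n n1 t y Psi c t0 (lexx _) mPsi Psi0 c0 H.
have -> : \int[mu]_(h in annulus t) Psi h = 0.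
  apply/eqP; rewrite eq_le integral_ge0// andbT -intPsi.
  apply: ge0_subset_integral => //; exact: measurable_annulus.
rewrite mule0 => c_le.
have cE : c = 0.
  apply/eqP; rewrite eq_le c0 andbT.
  by move: c_le; rewrite pmule_lle0// lte_fin exprn_gt0// mulr_gt0.
rewrite /modulus unlock; case: ifPn => // _.
apply/ess_supP.
have : \int[mu]_x `|E `|v (x + y) - v x|%R (2 * b)%R| = 0.
  by rewrite -[RHS]cE; apply: eq_integral => x _; rewrite gee0_abs.
move=> /ae_eq_integral_abs => /(_ measurableT mc).
apply: filterS => x /= /(_ I) [] mx; rewrite lee_fin -mulrA -/b -subr_le0.
by rewrite -[leRHS]mx le_max lexx.
Qed.

End modulus_bounds.

(** * Conclusion *)

Section final.
Context {R : realType} {n : nat}.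
Local Notation mu := (lebesgue_rV R n).
Hypothesis n1 : (0 < n)%N.

Lemma mdeg_eq0 (a : 'I_n -> nat) : mdeg a = 0%N -> a = fun=> 0%N.
Proof.
move=> a0; apply/funext => i; have := leq_mdeg i a.
by rewrite a0 leqn0 => /eqP.
Qed.

Lemma wderiveP (a : 'I_n -> nat) (u : 'rV[R]_n -> R) : weakly_derivable a u ->
  locally_integrable_rV (wderive a u) /\ tensor_weak a u (wderive a u).
Proof.
move=> [v uv]; rewrite /wderive; case: ifPn => [/eqP/mdeg_eq0 ->|_].
  by split; [case: uv|exact: tensor_weak0].
have h : is_weak_derivative a u (xget (cst 0) [set v | is_weak_derivative a u v]).
  by case: xgetP => [w -> //|/(_ v)].
by split; [case: h|exact: weak_derivative_tensor_weak].
Qed.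

(** The constants of the four cases, added up. *)
Definition modulus_const : R := 2 + n%:R + @gagliardo_const R n + 18 * n%:R.

Lemma modulus_const_gt0 : 0 < modulus_const.
Proof.
have h := @gagliardo_const_ge0 R n.
by rewrite /modulus_const; have : 0 <= n%:R :> R by []; lra.
Qed.

Lemma modulus_seminormW p (s M : R) (v : 'rV[R]_n -> R) y :
  (1 <= p)%E -> 0 <= s <= 1 -> 0 <= M -> locally_integrable_rV v ->
  (seminormW s p v <= M%:E)%E ->
  (modulus v p y <= (modulus_const * M * enorm y `^ s)%:E)%E.
Proof.
move=> p1 /andP[s0 s1] M0 lv; have [mv _] := lv.
have hg := @gagliardo_const_ge0 R n.
have n0 : 0 <= n%:R :> R by [].
have CE (c : R) : c <= modulus_const -> c * M * enorm y `^ s <= modulus_const * M * enorm y `^ s.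
  by move=> cC; rewrite ler_wpM2r ?powR_ge0// ler_wpM2r.
rewrite /seminormW; case: ifPn => [/eqP ->|sN0].
  move=> vM; apply: (le_trans (modulus_Lnorm y p1 mv)).
  apply: (@le_trans _ _ (2%:E * M%:E)%E); first by rewrite lee_wpmul2l.
  by rewrite powRr0 mulr1 -EFinM lee_fin ler_wpM2r// /modulus_const; lra.
case: ifPn => [/eqP sE|sN1].
  rewrite /grad_seminorm; case: ifPn => [/asboolP wv vM|_]; last by rewrite leye_eq.
  have h i := wderiveP (wv i).
  have iw i : cube_integrable (wderive (munit i) v).
    by apply: locally_integrable_cube; case: (h i).
  have vw i : tensor_weak (munit i) v (wderive (munit i) v) by case: (h i).
  apply: le_trans (modulus_grad y p1 M0 (locally_integrable_cube lv) iw vw vM) _.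
  rewrite lee_fin sE powRr1 ?enorm_ge0// mulrAC.
  by apply: ler_wpM2r; rewrite ?enorm_ge0// ler_wpM2r// /modulus_const; lra.
have s0' : 0 < s by rewrite lt_neqAle eq_sym sN0.
have s1' : s < 1 by rewrite lt_neqAle sN1.
case: p p1 => [r r1|_|//] vM.
  apply: le_trans (modulus_gagliardo n1 mv r1 s0' s1' y) _.
  apply: (@le_trans _ _ ((@gagliardo_const R n * enorm y `^ s)%:E * M%:E)%E).
    by rewrite lee_wpmul2l// lee_fin mulr_ge0 ?powR_ge0.
  by rewrite -EFinM lee_fin mulrAC; apply: CE; rewrite /modulus_const; lra.
apply: le_trans (modulus_hoelder y n1 s0 M0 mv vM) _.
rewrite lee_fin powRM ?mulr_ge0 ?enorm_ge0// mulrA.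
rewrite ler_wpM2r ?powR_ge0// mulrAC ler_wpM2r//.
have n9 : 1 <= 9 * n%:R :> R by have : 1 <= n%:R :> R; [rewrite ler1n|lra].
have := ler1_powR n9 s1; rewrite /modulus_const; lra.
Qed.

End final.

Theorem theorem1p2 (R : realType) (n k : nat) (n_ge1 : (1 <= n)%N) :
  exists C : R, 0 < C /\
    forall (p : \bar R) (s : R) (u : 'rV[R]_n -> R) (y : 'rV[R]_n),
      (1 <= p)%E -> 0 <= s <= 1 -> frac_sobolev k s p u ->
      ('N[lebesgue_rV R n]_p[(fun x => (u (x + y)%R - taylor k u x y)%:E)] <=
       C%:E * seminormWk k s p u * (enorm y `^ (k%:R + s))%:E)%E.
Proof.
exists (n%:R ^+ k * @modulus_const R n); split.
  by rewrite mulr_gt0 ?modulus_const_gt0// exprn_gt0// ltr0n.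
move=> p s u y p1 s01 [sob semi].
have /andP[s0 s1] := s01.
have semi0 : (0 <= seminormWk k s p u)%E by exact: bigmax_ge_id.
pose M := fine (seminormWk k s p u).
have ME : seminormWk k s p u = M%:E by rewrite fineK// ge0_fin_numE.
have M0 : 0 <= M by rewrite fine_ge0.
pose V a := wderive a u.
have wd a : (mdeg a <= k)%N -> weakly_derivable a u.
  by move=> ak; have [b bE] := mi_surj ak; rewrite -bE; apply: (sob b _).1; rewrite bE.
have iV a : (mdeg a <= k)%N -> cube_integrable (V a).
  by move=> ak; apply: locally_integrable_cube; case: (wderiveP (wd a ak)).
have VM a : mdeg a = k -> (seminormW s p (V a) <= M%:E)%E.
  move=> ak; have [b bE] := mi_surj (eq_leq ak).
  rewrite -ME /V -bE; apply: (@le_bigmax_cond _ _ _ _ b (fun b : bmindex n k => mdeg (mi b) == k)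
    (fun b => seminormW s p (wderive (mi b) u))).
  by rewrite bE ak.
have V0 : V (fun=> 0%N) = u by rewrite /V /wderive /mdeg big1.
have C0 := ltW (@modulus_const_gt0 R n).
have := @taylor_bound R n k p k V y (@modulus_const R n * M * enorm y `^ s) (enorm y) p1 (leqnn k) iV.
have -> : (fun x => (u (x + y) - taylor k u x y)%:E) = EFin \o (fun x => taylor_rem k k V x y).
  apply/funext => x /=; rewrite /taylor_rem V0 taylor_sum_terms.
  by [].
move=> H; apply: le_trans (H _ _ _ _ _) _.
- move=> a i ak; have ak' : (mdeg (mincr i a) <= k)%N by rewrite mdeg_mincr.
  have [_ t1] := wderiveP (wd a (ltnW ak)).
  have [_ t2] := wderiveP (wd _ ak').
  exact: tensor_weak_mincr t1 t2.
- exact: ler_coord_enorm.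
- exact: enorm_ge0.
- by rewrite !mulr_ge0// powR_ge0.
- move=> a t ak /andP[t0 t1].
  have lV : locally_integrable_rV (V a) by case: (wderiveP (wd a (eq_leq ak))).
  have := @modulus_seminormW R n n_ge1 p s M (V a) (t *: y) p1 s01 M0 lV (VM a ak).
  move=> /le_trans; apply; rewrite lee_fin ler_wpM2l ?mulr_ge0//.
  apply: (ge0_ler_powR s0); rewrite ?nnegrE ?enorm_ge0//.
  by rewrite enormZ ger0_norm// ler_piMl// enorm_ge0.
rewrite ME -!EFinM lee_fin exprMn -!mulrA ler_wpM2l ?exprn_ge0//.
rewrite mulrCA ler_wpM2l// mulrCA ler_wpM2l//.
rewrite -powR_mulrn ?enorm_ge0//.
(* For y = 0 the powers add up unless k + s = 0, when all exponents vanish. *)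
have [ks0|ksN0] := eqVneq (k%:R + s) 0.
  have k0 : k%:R = 0 :> R by have : 0 <= k%:R :> R by []; lra.
  have s0' : s = 0 by lra.
  by rewrite ks0 k0 s0' !powRr0 mulr1.
by rewrite powRD// (negbTE ksN0).
Qed.
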